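(* There exists a Gaussian threshold process $(X_i)_{i \in \mathbb{N}}$ that is negatively associated and has a trivial tail $\sigma$-field (i.e. $\mathbb{P}(E)\in\{0,1\}$ for every $E \in \bigcap_{n=1}^\infty \sigma(X_i : i \geq n)$), but does not have summable covariances, i.e. it is not the case that $\sum_{j=1}^\infty |\mathrm{cov}(X_i,X_j)| < \infty$ for every $i \in \mathbb{N}$.
   Context: A Gaussian process $(Z_i)_{i\in\mathbb{N}}$ is a sequence of random variables all of whose finite subfamilies are jointly Gaussian. A Gaussian threshold process is a process of the form $(1_{\{Z_i \geq a_i\}})_{i \in \mathbb{N}}$ with $(Z_i)_{i\in\mathbb{N}}$ a Gaussian process and $(a_i)_{i \in \mathbb{N}}$ a sequence of real numbers. A process $(X_i)_{i \in \mathbb{N}}$ is negatively associated if $\mathbb{E}[fg] \leq \mathbb{E}[f]\,\mathbb{E}[g]$ for every pair of coordinatewise increasing (i.e. nondecreasing) functions $f$ and $g$ of the process that depend on disjoint subsets of the components (and for which these expectations exist). *)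

(* Defs.v *)
From HB Require Import structures.
From mathcomp Require Import all_boot all_order all_algebra.
From mathcomp Require Import all_classical all_reals all_analysis.

Set Implicit Arguments.
Unset Strict Implicit.
Unset Printing Implicit Defensive.

Import Order.TTheory GRing.Theory Num.Theory.
Import numFieldNormedType.Exports.

Local Open Scope classical_set_scope.
Local Open Scope ring_scope.

(* The sigma-algebra sigma(X_i : i in J) on S. For S = nat -> R, X the
   coordinate maps and J = setT, it is the product Borel sigma-algebra. *)
Definition sigma_family (R : realType) (S I : Type) (X : I -> S -> R)
    (J : set I) : set (set S) :=
  <<s \bigcup_(i in J) preimage_set_system setT (X i) measurable >>.

Section processes.
Context {d : measure_display} {T : measurableType d} {R : realType}.
Variable P : probability T R.

(* Constants count as Gaussian. This case is kept separate because
   [normal_prob m 0] is not the point mass at m. *)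
Definition gaussian_rv (Y : T -> R) : Prop :=
  exists m s : R, forall B : set R, measurable B ->
    P (Y @^-1` B) = if s == 0 then \d_m B else normal_prob m s B.

Definition jointly_gaussian (n : nat) (Y : 'I_n -> T -> R) : Prop :=
  forall c : 'I_n -> R, gaussian_rv (fun w => \sum_(k < n) c k * Y k w).

Definition gaussian_process (Z : nat -> {RV P >-> R}) : Prop :=
  forall (n : nat) (t : 'I_n -> nat), injective t ->
    jointly_gaussian (fun k => Z (t k) : T -> R).

Definition gaussian_threshold_process (X : nat -> {RV P >-> R}) : Prop :=
  exists (Z : nat -> {RV P >-> R}) (a : nat -> R),
    gaussian_process Z /\
    forall i, X i = \1_[set w | a i <= Z i w] :> (T -> R).

Definition measurable_functional (f : (nat -> R) -> R) : Prop :=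
  forall B : set R, measurable B ->
    sigma_family (fun (i : nat) (x : nat -> R) => x i) setT (f @^-1` B).

Definition coordinatewise_nondecreasing (f : (nat -> R) -> R) : Prop :=
  forall x y : nat -> R, (forall i, x i <= y i) -> f x <= f y.

Definition depends_only_on (I : set nat) (f : (nat -> R) -> R) : Prop :=
  forall x y : nat -> R, (forall i, I i -> x i = y i) -> f x = f y.

Definition trajectory (X : nat -> {RV P >-> R}) (w : T) : nat -> R :=
  fun i => X i w.

(* I and J may be infinite. *)
Definition negatively_associated (X : nat -> {RV P >-> R}) : Prop :=
  forall (I J : set nat) (f g : (nat -> R) -> R),
    I `&` J = set0 ->
    depends_only_on I f -> depends_only_on J g ->
    measurable_functional f -> measurable_functional g ->
    coordinatewise_nondecreasing f -> coordinatewise_nondecreasing g ->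
    P.-integrable setT (fun w => (f (trajectory X w))%:E) ->
    P.-integrable setT (fun w => (g (trajectory X w))%:E) ->
    P.-integrable setT (fun w => (f (trajectory X w) * g (trajectory X w))%:E) ->
    ('E_P[fun w => (f (trajectory X w) * g (trajectory X w))%R] <=
     'E_P[fun w => (f (trajectory X w))%R] * 'E_P[fun w => (g (trajectory X w))%R])%E.

Definition tail_sigma_field (X : nat -> {RV P >-> R}) : set (set T) :=
  \bigcap_(n in [set: nat])
    sigma_family (fun i => X i : T -> R) [set i | (n <= i)%N].

Definition trivial_tail (X : nat -> {RV P >-> R}) : Prop :=
  forall E : set T, tail_sigma_field X E -> P E = 0%E \/ P E = 1%E.

Definition summable_covariances (X : nat -> {RV P >-> R}) : Prop :=
  forall i : nat,
    (\sum_(0 <= j <oo) `|covariance P (X i) (X j)| < +oo)%E.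

End processes.

(* Main.v *)
Require Import Defs.
From HB Require Import structures.
From mathcomp Require Import all_boot all_order all_algebra.
From mathcomp Require Import all_classical all_reals all_analysis.
From mathcomp Require Import measurable_realfun ring lra.

(* Let Z_0 be a standard Gaussian and g_1, g_2, ... be i.i.d. standard Gaussians
   independent of it. Rotating the pair (Z_0, g_1) by an angle with sine 1/2 gives
   an output Z_1 and an independent remainder; the remainder is rotated with g_2
   by an angle with sine 1/3, giving Z_2, and so on. The outputs Z_1, Z_2, ... are
   i.i.d. standard Gaussians, while cov(Z_0, Z_n) = - eps_n, where
   eps_n = sin(a_n) cos(a_1) ... cos(a_(n-1)) is at least of order 1/n. Let X be
   the threshold process of Z at level 0.
   - Since |cov(X_0, X_n)| >= c eps_n, the covariances of X_0 are not summable.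
   - X_1, X_2, ... are independent, so the tail is trivial by Kolmogorov's 0-1 law.
   - Conditionally on the signs of Z_1, ..., Z_n, the probability that Z_0 >= 0
     decreases in these signs; with Harris' inequality on the cube {0,1}^n, and
     approximation of the events by cylinders, this gives negative association.
   All the randomness comes from one uniform variable: its binary digits of even
   rank and those of odd rank give two independent uniform variables, the first
   of which is turned into a Gaussian by the quantile transform. *)

Set Implicit Arguments.
Unset Strict Implicit.
Unset Printing Implicit Defensive.

Import Order.TTheory GRing.Theory Num.Theory.
Import numFieldNormedType.Exports.

Local Open Scope classical_set_scope.
Local Open Scope ring_scope.

(** * Rotation invariance of the Gaussian measure *)

(** No infinite product space is used. A sample point is a pair: the current Gaussian state and a
    uniform variable holding all the randomness not yet consumed. A stage maps it to an output and a
    new sample point; rotation invariance makes these two independent and gives the new point the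
    old law. Statements about the whole sequence thus follow by induction on the number of stages,
    for all starting stages at once. The sines answer two constraints. By Bessel's inequality the
    covariances of Z_0 with an i.i.d. Gaussian sequence are square-summable, so order 1/n is a
    natural way of not being summable. With sines 1/2, 1/3, ... the product of the squared cosines
    telescopes and stays above 1/2, so eps_n keeps the order of its sine. In the negative
    association, X_0 is not a function of the other signs. An event f >= u in which X_0 occurs is
    cut into a part that holds whatever X_0 is and a part that needs Z_0 >= 0; in the second part
    the event Z_0 >= 0 enters Harris' inequality as a weight decreasing in every sign. *)

Section density.
Local Open Scope ereal_scope.
Context d (T : measurableType d) (R : realType).
Import HBNNSimple.

Lemma measure_integral_indic (mu : {measure set T -> \bar R}) (A : set T) :
  measurable A -> mu A = \int[mu]_x (\1_A x)%:E.
Proof. by move=> mA; rewrite integral_indic// setIT. Qed.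

Lemma ge0_integral_density (mu nu : {measure set T -> \bar R}) (f : T -> \bar R)
    (g : T -> \bar R) :
  measurable_fun setT f -> (forall x, 0 <= f x) ->
  (forall A, measurable A -> nu A = \int[mu]_(x in A) f x) ->
  measurable_fun setT g -> (forall x, 0 <= g x) ->
  \int[nu]_x g x = \int[mu]_x (g x * f x).
Proof.
move=> mf f0 nuE mg g0.
pose g_ := nnsfun_approx measurableT mg.
have mono : {homo g_ : m n / (m <= n)%N >-> forall x, (m x <= n x)%R}.
  by move=> m n mn x; exact/lefP/nd_nnsfun_approx.
have cvgg x : (g_ n x)%:E @[n --> \oo] --> g x by exact: cvg_nnsfun_approx.
transitivity (lim (\int[nu]_x (g_ n x)%:E @[n --> \oo])).
  rewrite -monotone_convergence//=.
  - by apply: eq_integral => x _; apply/esym/cvg_lim.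
  - by move=> n; exact/measurable_EFinP/measurable_funTS.
  - by move=> n x _; rewrite lee_fin.
  - by move=> x _ m n mn; rewrite lee_fin; exact: mono.
transitivity (lim (\int[mu]_x ((g_ n x)%:E * f x) @[n --> \oo])); last first.
  rewrite -monotone_convergence//=.
  - apply: eq_integral => x _; apply/cvg_lim => //.
    have [->|fx0] := eqVneq (f x) 0.
      rewrite mule0; under eq_fun do rewrite mule0; exact: cvg_cst.
    have [fx|fx] := boolP (f x \is a fin_num); first exact: cvgeZr.
    have {fx} fxy : f x = +oo by move: fx (f0 x); rewrite fin_numE; case: (f x).
    (* The product 0 * +oo is outside the scope of [cvgeM]; there every approximant is already 0,
       being squeezed between 0 and [g x]. *)
    have [gx0|gx0] := eqVneq (g x) 0.
      have gn0 n : g_ n x = 0%R.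
        have : ((g_ n x)%:E <= g x).
          rewrite -(cvg_lim _ (cvgg x))//; apply: lime_ge.
            by apply/cvg_ex; exists (g x).
          by exists n => // m /= nm; rewrite lee_fin; exact: mono.
        rewrite gx0 lee_fin => h; apply/le_anti; by rewrite h/=.
      rewrite gx0 mul0e; under eq_fun do rewrite gn0 mul0e; exact: cvg_cst.
    by apply: cvgeM => //; [rewrite mule_def_neq0_infty ?fxy|exact: cvg_cst].
  - by move=> n; apply: emeasurable_funM => //; exact/measurable_EFinP/measurable_funTS.
  - by move=> n x _; rewrite mule_ge0// lee_fin.
  - by move=> x _ m n mn; rewrite lee_wpmul2r// lee_fin; exact: mono.
apply/congr_lim/funext => n /=.
under [LHS]eq_integral do rewrite fimfunE -fsumEFin//.
rewrite [LHS]ge0_integral_fsum//; last 2 first.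
  - by move=> r; exact/measurable_EFinP/measurableT_comp.
  - by move=> m x _; rewrite EFinM nnfun_muleindic_ge0.
under [RHS]eq_integral.
  move=> x xD; rewrite fimfunE -fsumEFin// ge0_mule_fsuml; last first.
    by move=> r; rewrite EFinM nnfun_muleindic_ge0.
  over.
rewrite [RHS]ge0_integral_fsum//; last 2 first.
  - by move=> r; apply: emeasurable_funM => //; exact/measurable_EFinP/measurableT_comp.
  - by move=> m x _; rewrite mule_ge0// EFinM nnfun_muleindic_ge0.
apply: eq_fsbigr => r _.
rewrite integralZl_indic_nnsfun// integral_indic// setIT nuE//.
under [RHS]eq_integral do rewrite EFinM -muleA.
have [r0|r0] := leP 0%R r; last first.
  rewrite preimage_nnfun0// integral_set0 mule0 integral0_eq// => x _.
  by rewrite indic0 mul0e mule0.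
rewrite ge0_integralZl//.
- congr (_ * _); rewrite integral_mkcond; apply: eq_integral => x _.
  by rewrite patchE indicE; case: ifP => _; rewrite (mul1e, mul0e).
- by apply: emeasurable_funM => //; exact/measurable_EFinP.
- by move=> x _; rewrite mule_ge0// lee_fin.
Qed.

End density.

Section affine_substitution.
Local Open Scope ereal_scope.
Context {R : realType}.
Local Notation mu := (@lebesgue_measure R).

Lemma measurable_affine (a b : R) :
  measurable_fun [set: R] (fun x : R => a * x + b : measurableTypeR R)%R.
Proof. by apply: measurable_funD => //; exact: measurable_funM. Qed.

(** By uniqueness of Lebesgue measure it is enough to compare both sides on the intervals []c, d]].
    Their preimages are intervals again, with the ends exchanged when [a < 0]. *)
Lemma lebesgue_measure_affine (a b : R) (A : set R) : a != 0%R -> measurable A ->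
  mu A = `|a|%:E * mu ((fun x => a * x + b)%R @^-1` A).
Proof.
move=> a0 mA.
pose f : R -> measurableTypeR R := (fun x => a * x + b)%R.
have mf : measurable_fun setT f by exact: measurable_affine.
have a0' : (0 <= `|a|)%R by [].
pose nu : {measure set (measurableTypeR R) -> \bar R} :=
  mscale (NngNum a0') (pushforward mu (f : measurableTypeR R -> _)).
rewrite -[RHS]/(nu mf A).
apply: lebesgue_measure_unique => //= _ [[c d]]/= _ <-.
rewrite /nu /mscale/= /pushforward.
have [a_gt0|a_lt0|/eqP] := ltrgt0P a; last by rewrite (negbTE a0).
- rewrite (_ : _ @^-1` _ = `](c - b) / a, (d - b) / a]%classic)%R; last first.
    apply/seteqP; split => x /=; rewrite !in_itv/= ltr_pdivrMr// ler_pdivlMr//;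
    by rewrite ltrBlDr lerBrDr (mulrC x).
  rewrite !lebesgue_measure_itv/= !lte_fin ltr_pM2r ?invr_gt0// ltrD2r.
  case: ifPn => _; last by rewrite mule0.
  rewrite -!EFinB -EFinM; congr EFin; field; by rewrite gt_eqF.
- rewrite (_ : _ @^-1` _ = `[(d - b) / a, (c - b) / a[%classic)%R; last first.
    apply/seteqP; split => x /=; rewrite !in_itv/= ler_ndivrMr// ltr_ndivlMr//;
    by rewrite ltrBlDr lerBrDr (mulrC x) andbC.
  rewrite !lebesgue_measure_itv/= !lte_fin ltr_nM2r ?invr_lt0// ltrD2r.
  case: ifPn => _; last by rewrite mule0.
  rewrite -!EFinB -EFinM; congr EFin; field; by rewrite lt_eqF.
Qed.

Lemma ge0_integral_affine (a b : R) (f : R -> \bar R) : a != 0%R ->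
  measurable_fun setT f -> (forall x, 0 <= f x) ->
  \int[mu]_x f x = `|a|%:E * \int[mu]_x f (a * x + b)%R.
Proof.
move=> a0 mf f0.
have a0' : (0 <= `|a|)%R by [].
pose h : measurableTypeR R -> measurableTypeR R := (fun x => a * x + b)%R.
have mh : measurable_fun setT h by exact: measurable_affine.
rewrite -[in RHS](preimage_setT h).
rewrite -(@ge0_integral_pushforward _ _ _ _ _ _ mh mu setT f)//.
rewrite -(@ge0_integral_mscale _ _ _ _ _ measurableT (NngNum a0'))//.
apply: eq_measure_integral => A mA _ /=.
exact: lebesgue_measure_affine.
Qed.

End affine_substitution.

Section gauss.
Local Open Scope ereal_scope.
Context {R : realType}.
Local Notation mu := (@lebesgue_measure R).

Definition gauss : probability (measurableTypeR R) R :=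
  normal_prob (0 : R)%R 1%R.

Let phi (x : R) : R := normal_pdf (0 : R)%R 1%R x.

Let mphi : measurable_fun setT (EFin \o phi).
Proof. by apply/measurable_EFinP; exact: measurable_normal_pdf. Qed.

Let phi_ge0 x : (0 <= phi x)%R. Proof. exact: normal_pdf_ge0. Qed.

Lemma ge0_integral_gauss (f : R -> \bar R) : measurable_fun setT f ->
  (forall x, 0 <= f x) -> \int[gauss]_x f x = \int[mu]_x (f x * (phi x)%:E).
Proof. by move=> mf f0; rewrite (@ge0_integral_density _ _ _ mu _ (EFin \o phi)). Qed.

Definition rotation (c s : R) (z : R * R) : R * R :=
  ((c * z.1 + s * z.2)%R, (- s * z.1 + c * z.2)%R).

Lemma measurable_rotation c s : measurable_fun setT (rotation c s).
Proof.
apply/measurable_fun_pairP; split; apply: measurable_funD => //;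
  by apply: measurable_funM.
Qed.

Let phi_rot c s x y : (c ^+ 2 + s ^+ 2 = 1 ->
  phi (c * x + s * y) * phi (- s * x + c * y) = phi x * phi y)%R.
Proof.
move=> cs; rewrite /phi !normal_pdfE ?oner_neq0//.
rewrite mulrACA [RHS]mulrACA; congr (_ * _)%R.
rewrite /normal_fun -!expRD; congr expR.
rewrite -!mulrDl; congr (_ / _)%R.
have -> : (- (x - 0) ^+ 2 - (y - 0) ^+ 2 = - (c ^+ 2 + s ^+ 2) * (x ^+ 2 + y ^+ 2))%R.
  by rewrite cs; ring.
ring.
Qed.

(** Two one-dimensional substitutions separated by Tonelli replace a change of variables in the
    plane: [u = c * x + s * y] at fixed [y], then the second coordinate at fixed [u]. Their factors
    [1 / |c|] and [|c|] cancel; both divide by [c], whence [c != 0]. The density is invariant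
    because it depends on [x ^+ 2 + y ^+ 2] only. *)
Lemma ge0_integral_gauss_rotation (c s : R) (f : R * R -> \bar R) :
  c != 0%R -> (c ^+ 2 + s ^+ 2 = 1)%R ->
  measurable_fun setT f -> (forall x, 0 <= f x) ->
  \int[gauss \x gauss]_z f (rotation c s z) = \int[gauss \x gauss]_z f z.
Proof.
move=> c0 cs mf f0.
have lebE g : measurable_fun setT g -> (forall x, 0 <= g x) ->
    \int[gauss \x gauss]_z g z =
    \int[mu]_x \int[mu]_y (g (x, y) * (phi x * phi y)%:E).
  move=> mg g0; rewrite fubini_tonelli1//= ge0_integral_gauss//; last 2 first.
  - exact: measurable_fun_fubini_tonelli_F.
  - by move=> x; apply: integral_ge0.
  apply: eq_integral => x _; rewrite /fubini_F ge0_integral_gauss//; last first.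
    exact: measurableT_comp.
  rewrite -ge0_integralZr//.
  - by apply: eq_integral => y _; rewrite EFinM (muleC (phi x)%:E) muleA.
  - apply: emeasurable_funM => //; exact: measurableT_comp.
  - by move=> y _; rewrite mule_ge0// lee_fin.
  - by rewrite lee_fin.
have mfr : measurable_fun setT (fun z => f (rotation c s z)).
  exact: (measurableT_comp mf (measurable_rotation c s)).
rewrite (lebE _ mfr (fun z => f0 _)) (lebE f mf f0).
have swap (g : R * R -> \bar R) : measurable_fun setT g -> (forall z, 0 <= g z) ->
    \int[mu]_x \int[mu]_y g (x, y) = \int[mu]_y \int[mu]_x g (x, y).
  by move=> mg g0; exact: (@fubini_tonelli _ _ (measurableTypeR R) (measurableTypeR R) R).
have scale (k : R) (g : R -> \bar R) : measurable_fun setT g ->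
    (forall x, 0 <= g x) -> (0 <= k)%R ->
    \int[mu]_x (k%:E * g x) = k%:E * \int[mu]_x g x.
  by move=> mg g0 k0; rewrite ge0_integralZl.
pose G (z : R * R) := f z * (phi z.1 * phi z.2)%:E.
have mG : measurable_fun setT G.
  apply: emeasurable_funM => //.
  apply/measurable_EFinP; apply: measurable_funM;
  by apply: measurableT_comp => //; exact: measurable_normal_pdf.
have G0 z : 0 <= G z by rewrite mule_ge0// lee_fin mulr_ge0.
have mrot := measurable_rotation c s.
under eq_integral => x _ do under eq_integral => y _ do
  rewrite -(phi_rot x y cs) -[X in X * _]/(f (rotation c s (x, y))) -/(G (rotation c s (x, y))).
rewrite -[RHS]/(\int[mu]_x \int[mu]_y G (x, y)).
have mGr : measurable_fun setT (fun z => G (rotation c s z)).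
  exact: (measurableT_comp mG mrot).
apply: (etrans (swap (fun z => G (rotation c s z)) mGr (fun z => G0 _))).
have ci0 : (c^-1 != 0)%R by rewrite invr_eq0.
transitivity (\int[mu]_y \int[mu]_u (`|c^-1|%:E * G (u, (c^-1 * y + (- s * u / c))%R))).
  apply: eq_integral => y _.
  have mGy : measurable_fun setT (fun x : R => G (rotation c s (x, y : R))).
    by apply: (measurableT_comp mG); apply: (measurableT_comp mrot).
  apply: (etrans (ge0_integral_affine (- s * y / c) ci0 mGy (fun _ => G0 _))).
  have mGya : measurable_fun setT
      (fun x : R => G (rotation c s ((c^-1 * x + (- s * y / c))%R, y : R))).
    exact: (measurableT_comp mGy (measurable_affine _ _)).
  apply: (etrans (esym (scale _ _ mGya (fun _ => G0 _) (normr_ge0 _)))).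
  apply: eq_integral => u _; congr (_ * G _); rewrite /rotation/=.
  congr pair; first by field.
  have -> : (c * y = (c ^+ 2 + s ^+ 2) * y / c - s ^+ 2 * y / c)%R by field.
  by rewrite cs; field.
pose H (z : R * R) := `|c^-1|%:E * G (z.2, (c^-1 * z.1 + (- s * z.2 / c))%R).
have H0 z : 0 <= H z by rewrite mule_ge0.
have mH : measurable_fun setT H.
  apply: emeasurable_funM => //; apply: (measurableT_comp mG).
  have mH2 : measurable_fun setT (fun z : R * R => c^-1 * z.1 + (- s * z.2 / c))%R.
    apply: measurable_funD; first by apply: measurable_funM.
    by apply: measurable_funM => //; apply: measurable_funM.
  by apply/measurable_fun_pairP; split; [exact: measurable_snd|exact: mH2].
apply: (etrans (swap H mH H0)).
apply: eq_integral => u _.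
have mGu : measurable_fun setT (fun v : R => G (u : R, v)) by exact: measurableT_comp.
have mGua : measurable_fun setT (fun v : R => G (u : R, (c^-1 * v + (- s * u / c))%R)).
  exact: (measurableT_comp mGu (measurable_affine _ _)).
apply: (etrans (scale _ _ mGua (fun _ => G0 _) (normr_ge0 _))).
exact: (esym (ge0_integral_affine (- s * u / c) ci0 mGu (fun _ => G0 _))).
Qed.

Lemma gauss_rotation (c s : R) (A : set (R * R)) :
  c != 0%R -> (c ^+ 2 + s ^+ 2 = 1)%R -> measurable A ->
  (gauss \x gauss) (rotation c s @^-1` A) = (gauss \x gauss) A.
Proof.
move=> c0 cs mA.
have mrA : measurable (rotation c s @^-1` A).
  by rewrite -[X in measurable X]setTI; exact: measurable_rotation.
apply: (etrans (@measure_integral_indic _ _ _ (gauss \x gauss) _ mrA)).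
apply/esym/(etrans (@measure_integral_indic _ _ _ (gauss \x gauss) _ mA))/esym.
apply: (@ge0_integral_gauss_rotation c s (fun x => (\1_A x)%:E)) => //.
exact/measurable_EFinP.
Qed.

End gauss.

(** * A pair of independent variables from a uniform one *)

Section laws_on_the_line.
Local Open Scope ereal_scope.
Context {R : realType}.

Lemma measure_setI1 d (T : measurableType d) (m : probability T R) (A B : set T) :
  m B = 1 -> measurable A -> measurable B -> m A = m (A `&` B).
Proof.
move=> B1 mA mB; rewrite (measureDI m mA mB) setDE.
have /eqP : m (~` B) = 0 by rewrite probability_setC// B1 subee.
rewrite -measure_le0 => C0.
rewrite -[RHS]add0e; congr (_ + _); apply/eqP.
rewrite -measure_le0; apply: le_trans C0.
apply: le_measure; rewrite ?inE//; [|exact: measurableC].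
by apply: measurableI => //; exact: measurableC.
Qed.

Lemma cvge_ex_gt (f : (\bar R)^nat) (l u : \bar R) :
  f @ \oo --> l -> u < l -> exists n, u < f n.
Proof.
move=> fl; apply: contraPP => /forallNP uf; apply/negP; rewrite -leNgt.
rewrite -(cvg_lim _ fl)//; apply: lime_le; first by apply/cvg_ex; exists l.
by apply: nearW => n; rewrite leNgt; exact/negP.
Qed.

Lemma cvge_ex_lt (f : (\bar R)^nat) (l u : \bar R) :
  f @ \oo --> l -> l < u -> exists n, f n < u.
Proof.
move=> fl; apply: contraPP => /forallNP uf; apply/negP; rewrite -leNgt.
rewrite -(cvg_lim _ fl)//; apply: lime_ge; first by apply/cvg_ex; exists l.
by apply: nearW => n; rewrite leNgt; exact/negP.
Qed.

Lemma measure_eq_rays (m1 m2 : {measure set (measurableTypeR R) -> \bar R}) :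
  m1 setT < +oo -> (forall x, m1 `]-oo, x[%classic = m2 `]-oo, x[%classic) ->
  forall A, measurable A -> m1 A = m2 A.
Proof.
move=> m1T m12 A mA.
pose g (n : nat) : set (measurableTypeR R) := `]-oo, (n%:R : R)[%classic.
apply: (@measure_unique _ R (measurableTypeR R) (@RGenInftyO.G R) g) => //.
- exact: RGenInftyO.measurableE.
- move=> _ _ [x ->] [y ->]; exists (Order.min x y).
  by apply/seteqP; split => z /=; rewrite !in_itv/= lt_min => /andP.
- by move=> i; exists i%:R.
- rewrite -subTset => x _; exists (Num.truncn x).+1 => //.
  by rewrite /g /= in_itv/= truncnS_gt.
- by move=> _ [x ->].
- move=> k; apply: le_lt_trans m1T.
  by apply: le_measure; rewrite ?inE //; exact: measurable_itv.
Qed.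

Section quantile.
Variable m : probability (measurableTypeR R) R.

(** Open rays make the distribution function left-continuous, and with the strict inequality this
    gives the exact equivalence [quantile_lt]. The default 0 is taken on a set that is null for the
    uniform law. *)
Definition quantile (u : R) : R :=
  if (0 < u < 1)%R then inf [set y | u%:E < m `]-oo, y[%classic] else 0%R.

Let mle x y : (x <= y)%R -> m `]-oo, x[%classic <= m `]-oo, y[%classic.
Proof.
move=> xy; apply: le_measure; rewrite ?inE//.
by move=> z /=; rewrite !in_itv/= => /lt_le_trans; exact.
Qed.

Let lt_cdf_left u x : u < m `]-oo, x[%classic ->
  exists2 y, (y < x)%R & u < m `]-oo, y[%classic.
Proof.
move=> ux.
have : m `]-oo, (x - n.+1%:R^-1)%R[%classic @[n --> \oo] --> m `]-oo, x[%classic.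
  rewrite [X in _ --> m X](_ : _ = \bigcup_n `]-oo, (x - n.+1%:R^-1)%R[%classic).
    apply: nondecreasing_cvg_mu => //.
      exact: bigcup_measurable.
    move=> a b ab; apply/subsetPset => z /=; rewrite !in_itv/=.
    move=> /lt_le_trans; apply; rewrite lerD2l lerN2 lef_pV2 ?posrE//.
    by rewrite ler_nat.
  apply/seteqP; split => z /=; rewrite in_itv/=.
    move=> zx; have [n hn] := ltr_add_invr zx.
    by exists n => //=; rewrite in_itv/= ltrBrDr.
  by move=> [n _] /=; rewrite in_itv/= => /lt_le_trans; apply; rewrite gerBl.
move=> /cvge_ex_gt/(_ ux)[n h].
by exists (x - n.+1%:R^-1)%R => //; rewrite gtrBl.
Qed.

Let cdf_lt_some u : u < 1 -> exists x, u < m `]-oo, x[%classic.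
Proof.
move=> u1.
have : m `]-oo, n%:R[%classic @[n --> \oo] --> m setT.
  rewrite [X in _ --> m X](_ : _ = \bigcup_n `]-oo, n%:R[%classic).
    apply: nondecreasing_cvg_mu => //; first exact: bigcup_measurable.
    move=> a b ab; apply/subsetPset => z /=; rewrite !in_itv/=.
    by move=> /lt_le_trans; apply; rewrite ler_nat.
  apply/esym; rewrite -subTset => z _; exists (Num.truncn (z : R)).+1 => //=.
  by rewrite in_itv/= truncnS_gt.
rewrite probability_setT => /cvge_ex_gt/(_ u1)[n h].
by exists n%:R.
Qed.

Let cdf_gt_some u : 0 < u -> exists x, m `]-oo, x[%classic < u.
Proof.
move=> u0.
have : m `]-oo, (- n%:R)%R[%classic @[n --> \oo] --> m set0.
  rewrite [X in _ --> m X](_ : _ = \bigcap_n `]-oo, (- n%:R)%R[%classic).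
    apply: nonincreasing_cvg_mu => //.
    - by rewrite (le_lt_trans (probability_le1 _ _))// ltry.
    - exact: bigcap_measurable.
    move=> a b ab; apply/subsetPset => z /=; rewrite !in_itv/=.
    by move=> /lt_le_trans; apply; rewrite lerN2 ler_nat.
  apply/esym; rewrite -subset0 => z /(_ (Num.truncn (- z)).+1 Logic.I) /=.
  by rewrite in_itv/= ltrNr => /(lt_trans (truncnS_gt _)); rewrite ltxx.
rewrite measure0 => /cvge_ex_lt/(_ u0)[n h].
by exists (- n%:R)%R.
Qed.

Lemma quantile_lt u x : (0 < u < 1)%R ->
  (quantile u < x)%R = (u%:E < m `]-oo, x[%classic).
Proof.
move=> u01; rewrite /quantile u01; case/andP: u01 => u0 u1.
have hi : has_inf [set y | u%:E < m `]-oo, y[%classic].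
  split; first exact: cdf_lt_some.
  have [l hl] := @cdf_gt_some u%:E u0; exists l => y /= uy.
  rewrite leNgt; apply/negP => /ltW/mle/(lt_le_trans uy)/(lt_trans hl).
  by rewrite ltxx.
apply/idP/idP => [h|/lt_cdf_left[y yx uy]].
  have [y /= uy yx] := inf_lt hi.1 h.
  exact/(lt_le_trans uy)/mle/ltW.
by apply: le_lt_trans yx; apply: ge_inf => //; exact: hi.2.
Qed.

Lemma measurable_quantile :
  measurable_fun [set: measurableTypeR R] (quantile : _ -> measurableTypeR R).
Proof.
apply: (measurability _ (RGenInftyO.measurableE R)) => _ [_ [x ->] <-].
rewrite setTI.
rewrite (_ : _ @^-1` _ =
  (`]0%R, 1%R[%classic `&` `]-oo, fine (m `]-oo, x[%classic)[%classic) `|`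
  (~` `]0%R, 1%R[%classic `&` [set _ | (0 < x)%R])); last first.
  apply/seteqP; split => u /=; rewrite !in_itv/=.
    move=> h; have [u01|/negP u01] := boolP (0 < u < 1)%R.
      left; split => //; rewrite -lte_fin fineK ?fin_num_measure//.
      by rewrite -quantile_lt.
    right; split => //; move: h; rewrite /quantile; by move/negP/negbTE : u01 => ->.
  case=> [[u01]|[/negP/negbTE u01 x0]]; last by rewrite /quantile u01.
  by rewrite -lte_fin fineK ?fin_num_measure// quantile_lt.
apply: measurableU; first exact: measurableI.
apply: measurableI; first exact: measurableC.
have [x0|x0] := boolP (0 < x)%R.
  by rewrite (_ : [set _ | _] = setT)//; apply/seteqP.
by rewrite (_ : [set _ | _] = set0)//; apply/seteqP; split => // u/=; rewrite (negbTE x0).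
Qed.

End quantile.

Definition unif : probability (measurableTypeR R) R := uniform_prob (@ltr01 R).

Lemma unif_itv01 (A : set R) : measurable A ->
  unif A = lebesgue_measure (A `&` `[0%R, 1%R]%classic).
Proof.
move=> mA; rewrite /unif /= /uniform_prob integral_uniform_pdf.
rewrite (eq_integral (cst 1)) ?integral_cst ?mul1e//; first exact: measurableI.
move=> x; rewrite inE/= in_itv/= => -[_ x01].
by rewrite /uniform_pdf x01 subr0 invr1.
Qed.

(** The distribution function of the uniform law on [0, 1]. *)
Definition clamp (x : R) : R :=
  (if x <= 0 then 0 else if x <= 1 then x else 1)%R.

Lemma unif_ray x : unif `]-oo, x[%classic = (clamp x)%:E.
Proof.
rewrite unif_itv01//.
have [x0|x0] := leP x 0%R.
  rewrite (_ : _ `&` _ = set0) ?measure0 /clamp ?x0//.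
  rewrite -subset0 => z [] /=; rewrite !in_itv/= => zx /andP[z0 _].
  by move: (lt_le_trans zx x0); rewrite ltNge z0.
have [x1|x1] := leP x 1%R.
  rewrite (_ : _ `&` _ = `[0%R, x[%classic).
    rewrite lebesgue_measure_itv/= lte_fin x0 oppr0 adde0.
    by rewrite /clamp leNgt x0/= x1.
  apply/seteqP; split => z /=; rewrite !in_itv/=.
    by move=> [-> /andP[->]].
  by move=> /andP[-> zx]; rewrite zx (le_trans (ltW zx)).
rewrite (_ : _ `&` _ = `[0%R, 1%R]%classic).
  rewrite lebesgue_measure_itv/= lte_fin ltr01 oppr0 adde0.
  by rewrite /clamp !leNgt x0 x1.
apply/setIidPr => z /=; rewrite !in_itv/= => /andP[_ z1].
exact: le_lt_trans z1 _.
Qed.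

Lemma unif_quantile (m : probability (measurableTypeR R) R) (A : set R) :
  measurable A -> unif (quantile m @^-1` A) = m A.
Proof.
have mq := measurable_quantile m.
pose q : measurableTypeR R -> measurableTypeR R := quantile m.
pose nu : {measure set (measurableTypeR R) -> \bar R} := pushforward unif q.
apply: (@measure_eq_rays (nu mq) m).
  change (unif (q @^-1` setT) < +oo).
  by rewrite preimage_setT probability_setT ltry.
move=> x; rewrite /nu /= /pushforward.
(* Both events are cut down to []0, 1[], which has full mass: elsewhere [quantile] takes its default
   value and [quantile_lt] says nothing. *)
have I1 : unif `]0%R, 1%R[%classic = 1.
  rewrite unif_itv01// setIidl.
    by rewrite lebesgue_measure_itv/= lte_fin ltr01 oppr0 adde0.
  by move=> z /=; rewrite !in_itv/= => /andP[/ltW-> /ltW->].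
have mI : measurable (`]0%R, 1%R[%classic : set (measurableTypeR R)) by [].
have mqx : measurable (q @^-1` `]-oo, x[%classic).
  by rewrite -[X in measurable X]setTI; exact: mq.
rewrite (measure_setI1 I1 mqx mI).
rewrite -(fineK (fin_num_measure m `]-oo, x[%classic _))//.
set p := fine _.
have -> : p%:E = unif `]-oo, p[%classic.
  have p1 : (p <= 1)%R.
    by rewrite -lee_fin /p fineK ?fin_num_measure// probability_le1.
  have p0 : (0 <= p)%R by rewrite /p fine_ge0.
  rewrite unif_ray /clamp p1; congr EFin; case: ifPn => // pn.
  by apply/le_anti; rewrite p0 pn.
have mp : measurable (`]-oo, p[%classic : set (measurableTypeR R)) by [].
rewrite (measure_setI1 I1 mp mI); congr (unif _).
have qE z : (0 < z < 1)%R -> (q z < x)%R = (z < p)%R.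
  by move=> z01; rewrite /q quantile_lt// /p -lte_fin fineK// fin_num_measure.
apply/seteqP; split => z [/= h z01]; split => //; move: h z01;
  rewrite /= !in_itv/= => h z01.
- by rewrite -qE.
- by rewrite qE.
Qed.

End laws_on_the_line.

(** * Binary digits of a uniform variable *)

Section binary_digits.
Local Open Scope ereal_scope.
Context {R : realType}.
Local Notation unif := (@unif R).
Local Notation clamp := (@clamp R).

Definition bit (x : R) : bool := (2^-1 <= x)%R.

(** On [0, 1] this is the doubling map, which drops the first binary digit. It is not reduced
    outside, a null set for [unif]. *)
Definition dbl (x : R) : R := (2 * x - (bit x)%:R)%R.

Lemma measurable_bit (i : bool) :
  measurable ([set x | bit x = i] : set (measurableTypeR R)).
Proof.
case: i.
- rewrite (_ : [set x | _] = `[2^-1%R, +oo[%classic)//.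
  by apply/seteqP; split => x /=; rewrite in_itv/= andbT.
- rewrite (_ : [set x | _] = `]-oo, 2^-1%R[%classic)//.
  apply/seteqP; split => x /=; rewrite in_itv/= /bit ltNge;
    [by move=> ->|by move/negbTE].
Qed.

Lemma measurable_dbl :
  measurable_fun [set: measurableTypeR R] (dbl : _ -> measurableTypeR R).
Proof.
apply: measurable_funB; first exact: measurable_funM.
rewrite (_ : (fun x => _) = \1_[set x | bit x = true])%R.
  exact: measurable_indic (measurable_bit true).
by apply/funext => x; rewrite indicE; congr (nat_of_bool _)%:R; apply/idP/idP; rewrite inE.
Qed.

(** Self-similarity of the uniform law: a uniform variable is half the sum of a fair bit and an
    independent uniform variable. *)
Lemma clamp_half (x : R) : (2 * clamp x = clamp (2 * x) + clamp (2 * x - 1))%R.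
Proof. by rewrite /clamp; repeat (case: leP => ?); lra. Qed.

(** The first digit is a fair bit independent of the remaining expansion, which is uniform again. On
    rays both sides are explicit, and finite measures that agree on rays are equal. *)
Lemma unif_bit_dbl (i : bool) (A : set (measurableTypeR R)) : measurable A ->
  unif ([set x | bit x = i] `&` dbl @^-1` A) = 2^-1%:E * unif A.
Proof.
move=> mA.
pose D : measurableTypeR R -> measurableTypeR R := dbl.
have mD : measurable_fun setT D := measurable_dbl.
pose nu : {measure set (measurableTypeR R) -> \bar R} :=
  pushforward (mrestr unif (measurable_bit i)) D.
have h0 : (0 <= 2^-1 :> R)%R by [].
pose nu' : {measure set (measurableTypeR R) -> \bar R} := mscale (NngNum h0) unif.
rewrite -[RHS]/(nu' A) setIC -[LHS]/(nu mD A).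
apply: (@measure_eq_rays R (nu mD) nu' _ _ A mA).
  change (unif (D @^-1` setT `&` [set x | bit x = i]) < +oo).
  rewrite -ge0_fin_numE// fin_num_measure// preimage_setT setTI.
  exact: measurable_bit.
move=> x; change (unif (D @^-1` `]-oo, x[%classic `&` [set x | bit x = i]) =
   2^-1%:E * unif `]-oo, x[%classic).
rewrite unif_ray -EFinM; case: i {nu} => //=.
- have [x0|x0] := leP x 0%R.
    rewrite (_ : _ `&` _ = set0) ?measure0.
      by rewrite /clamp x0 mulr0.
    rewrite -subset0 => z []/=; rewrite in_itv/= /D /dbl => + bz.
    by rewrite bz /=; move: bz; rewrite /bit => b; lra.
  rewrite (_ : _ `&` _ = `]-oo, ((x + 1) / 2)%R[%classic `\` `]-oo, 2^-1%R[%classic).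
    set A' := `]-oo, ((x + 1) / 2)%R[%classic; set B' := `]-oo, 2^-1%R[%classic.
    have mA' : measurable (A' : set (measurableTypeR R)) by exact: measurable_itv.
    have mB' : measurable (B' : set (measurableTypeR R)) by exact: measurable_itv.
    have AB : A' `&` B' = B'.
      by apply/setIidr => z; rewrite /A' /B' /= !in_itv/= => ?; lra.
    have E : unif A' = unif (A' `\` B') + unif B'.
      by rewrite -{2}AB; exact: measureDI.
    have fS : unif (A' `\` B') \is a fin_num.
      by rewrite fin_num_measure//; exact: measurableD.
    move: E; rewrite !unif_ray -(fineK fS) -EFinD => -[E].
    apply: (etrans (esym (fineK fS))); congr EFin.
    by move: E; rewrite /clamp; repeat (case: leP => ?); lra.
  apply/seteqP; split => z []/=; rewrite !in_itv/= /D /dbl.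
    move=> + bz; rewrite bz/= => ?; split; first by lra.
    by apply/negP; rewrite -leNgt; exact: bz.
  move=> zx /negP; rewrite -leNgt => bz.
  have bz' : bit z by exact: bz.
  by rewrite bz'/=; split => //; lra.
- rewrite (_ : _ `&` _ = `]-oo, (Order.min (x / 2) 2^-1)%R[%classic).
    rewrite unif_ray; congr EFin.
    by have [h|h] := leP (x / 2)%R 2^-1%R; rewrite /clamp;
      repeat (case: leP => ?); lra.
  apply/seteqP; split => z/=; rewrite !in_itv/= /D /dbl lt_min.
    move=> [+ bz]; rewrite bz/= subr0 => ?; apply/andP; split; first lra.
    by move: bz => /negbT; rewrite -ltNge.
  move=> /andP[zx]; rewrite ltNge => /negbTE bz.
  have bz' : bit z = false by exact: bz.
  by rewrite bz'/= subr0; split => //; lra.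
Qed.

(** Digits are ranked from 0; those of even rank become consecutive digits of the result. The digits
    of odd rank are obtained by applying the same map to [dbl x]. *)
Fixpoint even_bits_approx (n : nat) (x : R) : R :=
  if n is n'.+1 then (((bit x)%:R + even_bits_approx n' (dbl (dbl x))) / 2)%R
  else 0%R.

Let approx_itv n x : (0 <= even_bits_approx n x <= 1)%R.
Proof.
elim: n x => [|n IH] x /=; first by rewrite lexx ler01.
have /andP[h0 h1] := IH (dbl (dbl x)).
by case: (bit x) => /=; lra.
Qed.

Let approx_nd x : nondecreasing_seq (even_bits_approx ^~ x).
Proof.
apply/nondecreasing_seqP => n; elim: n x => [|n IH] x.
  by have /andP[] := approx_itv 1 x.
by rewrite [leLHS]/= [leRHS]/= ler_pM2r// lerD2l; exact: IH.
Qed.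

Definition even_bits (x : R) : R := lim (even_bits_approx n x @[n --> \oo])%R.

Let even_bits_cvg x : even_bits_approx n x @[n --> \oo] --> even_bits x.
Proof.
apply/cvg_ex.
by exists (sup (range (even_bits_approx ^~ x))); apply: nondecreasing_cvgn;
  [exact: approx_nd|exists 1%R => _ [n _ <-]; have /andP[] := approx_itv n x].
Qed.

Lemma measurable_even_bits :
  measurable_fun [set: measurableTypeR R] (even_bits : _ -> measurableTypeR R).
Proof.
have D := measurable_dbl.
apply: (@measurable_fun_cvg _ _ R setT (fun n => even_bits_approx n : measurableTypeR R -> _)) => //=.
elim=> [|n IH] /=; first exact: measurable_cst.
apply: measurable_funM => //; apply: measurable_funD.
  rewrite (_ : (fun x => _) = \1_[set x | bit x = true])%R.
    exact: measurable_indic (measurable_bit true).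
  by apply/funext => x; rewrite indicE; congr (nat_of_bool _)%:R; apply/idP/idP; rewrite inE.
exact: (measurableT_comp IH (measurableT_comp D D)).
Qed.

Lemma even_bits_itv x : (0 <= even_bits x <= 1)%R.
Proof.
apply/andP; split.
- by apply: limr_ge; [apply/cvg_ex; exists (even_bits x); exact: even_bits_cvg|
    apply: nearW => n; have /andP[] := approx_itv n x].
- by apply: limr_le; [apply/cvg_ex; exists (even_bits x); exact: even_bits_cvg|
    apply: nearW => n; have /andP[] := approx_itv n x].
Qed.

Lemma even_bitsE x : even_bits x = (((bit x)%:R + even_bits (dbl (dbl x))) / 2)%R.
Proof.
apply/cvg_lim => //; rewrite -cvg_shiftS /=.
apply: cvgM; last exact: cvg_cst.
by apply: cvgD; [exact: cvg_cst|exact: even_bits_cvg].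
Qed.

End binary_digits.

(** * Independence of the digits of even and of odd rank *)

Section bit_splitting.
Local Open Scope ereal_scope.
Context {R : realType}.
Local Notation unif := (@unif R).
Local Notation clamp := (@clamp R).
Local Notation mR := (measurableTypeR R).

Lemma unif_bit_split (A : set mR) (A' : bool -> set mR) :
  measurable A -> (forall i, measurable (A' i)) ->
  (forall x, A x <-> A' (bit x) (dbl x)) ->
  unif A = (2^-1 * (fine (unif (A' true)) + fine (unif (A' false))))%:E.
Proof.
move=> mA mA' AA'.
have mb := @measurable_bit R.
have Ei i : A `&` [set x | bit x = i] = [set x | bit x = i] `&` dbl @^-1` (A' i).
  apply/seteqP; split => x /= [].
    by move=> /AA' + <-.
  by move=> <- /AA'.
have -> : unif A = unif (A `&` [set x | bit x = true]) +
    unif (A `&` [set x | bit x = false]).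
  rewrite addeC; apply: (etrans (measureDI unif mA (mb true))).
  congr (_ + _); congr (unif _); apply/seteqP; split => x /= [Ax].
    by move/negP/negbTE.
  by move=> bx; split => //; rewrite bx.
rewrite !Ei !unif_bit_dbl// mulrDr EFinD !EFinM !fineK ?fin_num_measure//.
Qed.

Lemma unif_dbl (A : set mR) : measurable A -> unif (dbl @^-1` A) = unif A.
Proof.
move=> mA.
have mdA : measurable (dbl @^-1` A : set mR).
  by rewrite -[X in measurable X]setTI; exact: measurable_dbl.
rewrite (@unif_bit_split _ (fun=> A))// -[RHS]fineK ?fin_num_measure//.
by congr EFin; lra.
Qed.

Let e := @even_bits R.

Let me_ray s : measurable ([set x | e x < s]%R : set mR).
Proof.
rewrite (_ : [set x | _] = e @^-1` `]-oo, s[%classic); last first.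
  by apply/seteqP; split => x /=; rewrite in_itv.
by rewrite -[X in measurable X]setTI; exact: measurable_even_bits.
Qed.

Let md A : measurable A -> measurable (dbl @^-1` A : set mR).
Proof. by move=> mA; rewrite -[X in measurable X]setTI; exact: measurable_dbl. Qed.

Let e_lt x s : (e x < s)%R <-> (e (dbl (dbl x)) < 2 * s - (bit x)%:R)%R.
Proof.
rewrite {1}/e even_bitsE -/e.
by split => ?; lra.
Qed.

Let G (s : R) := fine (unif [set x | e x < s]%R).

Let G_rec s : (2 * G s = G (2 * s - 1) + G (2 * s))%R.
Proof.
rewrite {1}/G.
rewrite (@unif_bit_split _ (fun i => [set x | e (dbl x) < 2 * s - i%:R]%R))//=.
  rewrite -/(dbl @^-1` [set x | e x < 2 * s - 1]%R).
  rewrite -/(dbl @^-1` [set x | e x < 2 * s - 0]%R).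
  by rewrite !unif_dbl// subr0 -/(G _) -/(G _); lra.
by move=> i; exact: (md (me_ray (2 * s - i%:R)%R)).
Qed.

Let G0 s : (s <= 0)%R -> G s = 0%R.
Proof.
move=> s0; rewrite /G (_ : [set x | _] = set0) ?measure0//.
rewrite -subset0 => x /=; have /andP[] := even_bits_itv x; rewrite -/(e x); lra.
Qed.

Let G1 s : (1 < s)%R -> G s = 1%R.
Proof.
move=> s0; rewrite /G (_ : [set x | _] = setT) ?probability_setT//.
apply/seteqP; split => x //= _.
by have /andP[] := even_bits_itv x; rewrite -/(e x); lra.
Qed.

Let fine_unif01 A : measurable A -> (0 <= fine (unif A) <= 1)%R.
Proof.
move=> mA; rewrite fine_ge0//= -lee_fin fineK ?fin_num_measure//.
exact: probability_le1.
Qed.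

Let clamp01 s : (0 <= clamp s <= 1)%R.
Proof. by rewrite /clamp; repeat case: ifPn => //; lra. Qed.

Let c0 u : (u <= 0)%R -> clamp u = 0%R. Proof. by move=> h; rewrite /clamp h. Qed.

Let c1 u : (1 < u)%R -> clamp u = 1%R.
Proof. by move=> h; rewrite /clamp !leNgt h (lt_trans ltr01 h). Qed.

Let le_half_pow (x : R) : (forall n, `|x| <= 2^-1 ^+ n)%R -> x = 0%R.
Proof.
move=> h; apply/eqP; rewrite -normr_eq0; apply/eqP/le_anti; rewrite normr_ge0 andbT.
have := @cvg_geometric R 1%R 2^-1%R.
rewrite ger0_norm// => /(_ ltac:(lra)) cv.
rewrite -(cvg_lim _ cv)//; apply: limr_ge; first by apply/cvg_ex; exists 0%R.
by apply: nearW => n; rewrite /geometric /= mul1r.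
Qed.

(* [G - clamp] satisfies the same self-similarity relation as [G] (see [G_rec])
   and vanishes off [0, 1], hence its supremum norm is at most half itself. *)
Let G_clamp s : G s = clamp s.
Proof.
apply/eqP; rewrite -subr_eq0; apply/eqP/le_half_pow => n.
elim: n s => [|n IH] s.
  rewrite expr0; have := fine_unif01 (me_ray s); have := clamp01 s.
  by rewrite -/(G s) ler_norml; lra.
have [s0|s0] := leP s 0%R.
  by rewrite G0// c0// subrr normr0 exprn_ge0.
have [s1|s1] := ltP 1%R s.
  by rewrite G1// c1// subrr normr0 exprn_ge0.
have := G_rec s; have := clamp_half s => c g.
have {c g} -> : (G s - clamp s = 2^-1 *
  ((G (2 * s - 1) - clamp (2 * s - 1)) + (G (2 * s) - clamp (2 * s))))%R by lra.
rewrite normrM ger0_norm// exprS ler_pM2l//.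
have [h|h] := leP (2 * s - 1)%R 0%R.
  by rewrite c0// G0// subrr add0r; exact: IH.
have h1 : (1 < 2 * s)%R by lra.
by rewrite (G1 h1) (c1 h1) subrr addr0; exact: IH.
Qed.

Let H (s t : R) := fine (unif ([set x | e x < s]%R `&` [set x | e (dbl x) < t]%R)).

Let mH s t : measurable ([set x | e x < s]%R `&` [set x | e (dbl x) < t]%R : set mR).
Proof. by apply: measurableI; [exact: me_ray|exact: (md (me_ray t))]. Qed.

Let H_rec s t : (4 * H s t = H (2 * s - 1) (2 * t - 1) + H (2 * s - 1) (2 * t) +
  (H (2 * s) (2 * t - 1) + H (2 * s) (2 * t)))%R.
Proof.
rewrite {1}/H.
pose A1 i : set mR := [set x | e (dbl x) < 2 * s - i%:R]%R `&` [set x | e x < t]%R.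
pose A2 (i j : bool) : set mR :=
  [set x | e x < 2 * s - i%:R]%R `&` [set x | e (dbl x) < 2 * t - j%:R]%R.
have mA1 (i : bool) : measurable (A1 i).
  by apply: measurableI; [exact: (md (me_ray (2 * s - i%:R)%R))|exact: me_ray].
have mA2 i j : measurable (A2 i j) by exact: mH.
have E2 (i : bool) : unif (A1 i) = (2^-1 * (H (2 * s - i%:R) (2 * t - 1) + H (2 * s - i%:R) (2 * t)))%:E.
  rewrite (@unif_bit_split _ (A2 i))//.
    by rewrite /A2 /= -/(H _ _) -/(H _ _) subr0.
  by move=> x; split => -[h k]; split => //; exact/(e_lt x t).
rewrite (@unif_bit_split _ A1)//.
  by rewrite !E2 /= subr0; lra.
by move=> x; split => -[h k]; split => //; exact/(e_lt x s).
Qed.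

(** The contraction argument of [G_clamp] in two variables. The defect [D] is a quarter of the sum
    of four of its values ([H_rec]), and it vanishes off the unit square. Since [2 * s - 1 <= 0] or
    [1 < 2 * s], and likewise for [t], at most one of the four survives. The factor 1/4 is weakened
    to 1/2 to reuse [le_half_pow]. *)
Let H_clamp s t : H s t = (clamp s * clamp t)%R.
Proof.
have H0s u v : (u <= 0)%R -> H u v = 0%R.
  move=> u0; rewrite /H (_ : _ `&` _ = set0) ?measure0//.
  rewrite -subset0 => x /= []; have /andP[] := even_bits_itv x; rewrite -/(e x); lra.
have H0t u v : (v <= 0)%R -> H u v = 0%R.
  move=> v0; rewrite /H (_ : _ `&` _ = set0) ?measure0//.
  rewrite -subset0 => x /= []; have /andP[] := even_bits_itv (dbl x); rewrite -/(e (dbl x)); lra.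
have H1s u v : (1 < u)%R -> H u v = clamp v.
  move=> u1; rewrite /H (_ : _ `&` _ = dbl @^-1` [set x | e x < v]%R).
    by rewrite unif_dbl// -/(G v) G_clamp.
  apply/setIidr => x _ /=; have /andP[] := even_bits_itv x; rewrite -/(e x); lra.
have H1t u v : (1 < v)%R -> H u v = clamp u.
  move=> v1; rewrite /H (_ : _ `&` _ = [set x | e x < u]%R).
    by rewrite -/(G u) G_clamp.
  apply/setIidl => x _ /=; have /andP[] := even_bits_itv (dbl x); rewrite -/(e (dbl x)); lra.
apply/eqP; rewrite -subr_eq0; apply/eqP/le_half_pow => n.
have pow0 m : (0 <= 2^-1 ^+ m :> R)%R by rewrite exprn_ge0.
elim: n s t => [|n IH] s t.
  rewrite expr0; have /andP[a1 a2] := fine_unif01 (mH s t).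
  have /andP[b1 b2] := clamp01 s; have /andP[d1 d2] := clamp01 t.
  rewrite -/(H s t) in a1 a2.
  by rewrite ler_norml; apply/andP; split; nra.
pose D u v := (H u v - clamp u * clamp v)%R.
have D0 u v : (u <= 0 \/ 1 < u \/ v <= 0 \/ 1 < v)%R -> D u v = 0%R.
  rewrite /D; case=> [h|[h|[h|h]]].
  - by rewrite (H0s _ _ h) (c0 h) mul0r subrr.
  - by rewrite (H1s _ _ h) (c1 h) mul1r subrr.
  - by rewrite (H0t _ _ h) (c0 h) mulr0 subrr.
  - by rewrite (H1t _ _ h) (c1 h) mulr1 subrr.
have DE u v : (4 * D u v = D (2 * u - 1) (2 * v - 1) + D (2 * u - 1) (2 * v) +
  (D (2 * u) (2 * v - 1) + D (2 * u) (2 * v)))%R.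
  rewrite /D mulrBr H_rec.
  have -> : (4 * (clamp u * clamp v) = (2 * clamp u) * (2 * clamp v))%R by ring.
  by rewrite !clamp_half; ring.
rewrite -/(D s t).
have -> : D s t = (2^-1 * (2^-1 * (4 * D s t)))%R by lra.
rewrite DE.
have IH' u v : (`|2^-1 * D u v| <= 2^-1 ^+ n)%R.
  rewrite normrM ger0_norm//; apply: le_trans (IH u v); rewrite -/(D u v).
  by rewrite ler_piMl//; lra.
rewrite exprS normrM ger0_norm// ler_pM2l//.
have [h1|h1] := leP (2 * s - 1)%R 0%R; have [h2|h2] := leP (2 * t - 1)%R 0%R.
- rewrite (D0 (2 * s - 1)%R _ (or_introl h1)) (D0 (2 * s - 1)%R _ (or_introl h1)).
  by rewrite (D0 (2 * s)%R (2 * t - 1)%R) ?addr0 ?add0r//; right; right; left.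
- rewrite (D0 (2 * s - 1)%R _ (or_introl h1)) (D0 (2 * s - 1)%R _ (or_introl h1)).
  by rewrite (D0 (2 * s)%R (2 * t)%R) ?addr0 ?add0r//; right; right; right; lra.
- rewrite (D0 (2 * s - 1)%R (2 * t - 1)%R) ?add0r; last by right; right; left.
  have k : (1 < 2 * s)%R by lra.
  by rewrite (D0 (2 * s)%R _ (or_intror (or_introl k))) (D0 (2 * s)%R _ (or_intror (or_introl k))) !addr0.
- have k : (1 < 2 * s)%R by lra.
  have k' : (1 < 2 * t)%R by lra.
  rewrite (D0 (2 * s)%R _ (or_intror (or_introl k))) (D0 (2 * s)%R _ (or_intror (or_introl k))).
  by rewrite (D0 (2 * s - 1)%R (2 * t)%R) ?addr0//; right; right; right.
Qed.

(** The product formula for two rays is extended one coordinate at a time: with one event fixed,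
    both sides are finite measures of the other. *)
Lemma unif_even_odd (A B : set mR) : measurable A -> measurable B ->
  unif (even_bits @^-1` A `&` (even_bits \o dbl) @^-1` B) = unif A * unif B.
Proof.
have me := @measurable_even_bits R.
pose e1 : mR -> mR := e; pose e2 : mR -> mR := e \o dbl.
have me2 : measurable_fun setT e2.
  exact: (measurableT_comp me (@measurable_dbl R)).
have mp (f : mR -> mR) : measurable_fun setT f -> forall C : set mR,
    measurable C -> measurable (f @^-1` C).
  by move=> mf C mC; rewrite -[X in measurable X]setTI; exact: mf.
pose nu1 B (mB : measurable B) : {measure set mR -> \bar R} :=
  pushforward (mrestr unif (mp e2 me2 B mB)) e1.
pose scl (r : {nonneg R}) : {measure set mR -> \bar R} := mscale r unif.
pose nu2 A (mA : measurable A) : {measure set mR -> \bar R} :=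
  pushforward (mrestr unif (mp e1 me A mA)) e2.
have fin_lt (C : set mR) : measurable C -> unif C < +oo.
  by move=> mC; rewrite -ge0_fin_numE// fin_num_measure.
have HH s (t : R) : unif (e1 @^-1` `]-oo, s[%classic `&` e2 @^-1` `]-oo, t[%classic) =
    (clamp s)%:E * (clamp t)%:E.
  have -> : e1 @^-1` `]-oo, s[%classic = [set x | e x < s]%R.
    by apply/seteqP; split => x /=; rewrite in_itv.
  have -> : e2 @^-1` `]-oo, t[%classic = [set x | e (dbl x) < t]%R.
    by apply/seteqP; split => x /=; rewrite in_itv.
  rewrite -EFinM -H_clamp.
  exact: (esym (fineK (fin_num_measure unif _ (mH s t)))).
have step1 t (C : set mR) : measurable C ->
    unif (e1 @^-1` C `&` e2 @^-1` `]-oo, t[%classic) = (clamp t)%:E * unif C.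
  move=> mC.
  have t0 : (0 <= clamp t)%R by have /andP[] := clamp01 t.
  have mt : measurable (`]-oo, t[%classic : set mR) by exact: measurable_itv.
  change (nu1 me _ mt C = scl (NngNum t0) C).
  apply: (@measure_eq_rays R (nu1 me _ mt) (scl (NngNum t0)) _ _ C mC).
    exact: (fin_lt _ (measurableI _ _ (mp _ me _ measurableT) (mp _ me2 _ mt))).
  move=> s; apply: (etrans (HH s t)); rewrite muleC; congr (_ * _).
  exact: (esym (unif_ray s)).
move=> mA mB; rewrite setIC muleC.
have fA : unif A \is a fin_num by rewrite fin_num_measure.
have a0 : (0 <= fine (unif A))%R by rewrite fine_ge0.
rewrite -[X in _ * X](fineK fA) muleC.
change (nu2 me2 _ mA B = scl (NngNum a0) B).
apply: (@measure_eq_rays R (nu2 me2 _ mA) (scl (NngNum a0)) _ _ B mB).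
  exact: (fin_lt _ (measurableI _ _ (mp _ me2 _ measurableT) (mp _ me _ mA))).
move=> t; change (unif (e2 @^-1` `]-oo, t[%classic `&` e1 @^-1` A) =
  (fine (unif A))%:E * unif `]-oo, t[%classic).
by rewrite setIC step1// unif_ray fineK// muleC.
Qed.

End bit_splitting.

Lemma measurable_preimageT d1 d2 (T1 : measurableType d1) (T2 : measurableType d2)
    (f : T1 -> T2) (A : set T2) :
  measurable_fun setT f -> measurable A -> measurable (f @^-1` A).
Proof. by move=> mf mA; rewrite -[X in measurable X]setTI; exact: mf. Qed.

Section product_sections.
Local Open Scope ereal_scope.
Context d1 d2 (T1 : measurableType d1) (T2 : measurableType d2) (R : realType).
Variables (m1 : {measure set T1 -> \bar R}) (m2 : {sigma_finite_measure set T2 -> \bar R}).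

Lemma xsection_set (A : set (T1 * T2)) x : xsection A x = [set y | A (x, y)].
Proof. by apply/seteqP; split => y; rewrite /xsection /= inE. Qed.

Lemma product_measure_xsection (A : set (T1 * T2)) :
  (m1 \x m2) A = \int[m1]_x m2 [set y | A (x, y)].
Proof. by apply: eq_integral => x _ /=; rewrite xsection_set. Qed.

Lemma measurable_xsection_set (A : set (T1 * T2)) : measurable A ->
  measurable_fun setT (fun x => m2 [set y | A (x, y)]).
Proof.
move=> mA; under eq_fun do rewrite -xsection_set.
exact: measurable_fun_xsection.
Qed.

End product_sections.

Lemma product_measure_ysection d1 d2 (T1 : measurableType d1)
    (T2 : measurableType d2) (R : realType)
    (m1 : {sigma_finite_measure set T1 -> \bar R})
    (m2 : {sigma_finite_measure set T2 -> \bar R}) (A : set (T1 * T2)) :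
  measurable A -> (m1 \x m2)%E A = (\int[m2]_y m1 [set x | A (x, y)])%E.
Proof.
move=> mA; rewrite measure_integral_indic//.
have mf : measurable_fun setT (fun z => (\1_A z)%:E : \bar R).
  exact/measurable_EFinP.
apply: (etrans (@fubini_tonelli2 _ _ _ _ _ m1 m2 _ mf _)).
  by move=> z; rewrite lee_fin.
apply: eq_integral => y _; apply/esym.
have mAy : measurable [set x | A (x, y)].
  exact: (@measurable_preimageT _ _ _ _ (fun x => (x, y)) A).
apply: (etrans (measure_integral_indic m1 mAy)); apply: eq_integral => x _.
by rewrite !indicE; congr (nat_of_bool _)%:R%:E; apply/idP/idP; rewrite !inE.
Qed.

(** * One stage of the chain and the measure it preserves *)

Section dynamics.
Local Open Scope ereal_scope.
Context {R : realType}.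
Local Notation mR := (measurableTypeR R).
Local Notation unif := (@unif R).
Local Notation gauss := (@gauss R).

Definition split_unif (x : mR) : mR * mR :=
  (quantile gauss (even_bits x), even_bits (dbl x)).

Lemma measurable_split_unif : measurable_fun setT split_unif.
Proof.
apply/measurable_fun_pairP; split.
  exact: (measurableT_comp (measurable_quantile gauss) (@measurable_even_bits R)).
exact: (measurableT_comp (@measurable_even_bits R) (@measurable_dbl R)).
Qed.

Lemma unif_split_unif (S : set (mR * mR)) : measurable S ->
  unif (split_unif @^-1` S) = (gauss \x unif) S.
Proof.
move=> mS.
pose nu : {measure set (mR * mR) -> \bar R} := pushforward unif split_unif.
apply/esym.
apply: (@product_measure_unique _ _ _ _ _ gauss unif (nu measurable_split_unif) _ S mS).
move=> A B mA mB.
have mqA : measurable (quantile gauss @^-1` A : set mR).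
  by rewrite -[X in measurable X]setTI; exact: measurable_quantile.
apply: (etrans (unif_even_odd mqA mB)); congr (_ * _).
exact: unif_quantile.
Qed.

(** The first coordinate is the current state, the second the supply of randomness not yet used. *)
Definition base : probability (mR * mR)%type R := (gauss \x unif).

(* The inverse rotation recovers the state: [w.1] is [c] times the new state
   minus [s] times the output. *)
Definition step (c s : R) (w : mR * mR) : mR * (mR * mR) :=
  ((- s * w.1 + c * (split_unif w.2).1)%R,
   ((c * w.1 + s * (split_unif w.2).1)%R, (split_unif w.2).2)).

Lemma measurable_step c s : measurable_fun setT (step c s).
Proof.
have m1 : measurable_fun setT (fun w : mR * mR => (split_unif w.2).1).
  exact: (measurableT_comp measurable_fst (measurableT_comp measurable_split_unif measurable_snd)).
have m2 : measurable_fun setT (fun w : mR * mR => (split_unif w.2).2).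
  exact: (measurableT_comp measurable_snd (measurableT_comp measurable_split_unif measurable_snd)).
have ml (a b : R) : measurable_fun setT
    (fun w : mR * mR => (a * w.1 + b * (split_unif w.2).1)%R : mR).
  by apply: measurable_funD; apply: measurable_funM => //; exact: measurable_fst.
apply/measurable_fun_pairP; split; first exact: ml.
by apply/measurable_fun_pairP; split; [exact: ml|exact: m2].
Qed.

(** The supply splits into a fresh Gaussian and a new supply independent of it. State and fresh
    Gaussian form a pair invariant under rotation, so output and new state are independent
    Gaussians, both independent of the new supply. *)
Lemma base_step (c s : R) (S : set (mR * (mR * mR))) :
  c != 0%R -> (c ^+ 2 + s ^+ 2 = 1)%R -> measurable S ->
  base (step c s @^-1` S) = (gauss \x base) S.
Proof.
move=> c0 cs mS.
(* Integrating out the new supply leaves a function of the rotated pair. [rotation] lists the new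
   state first and the output second, while [S] expects the output first. *)
pose G (z : mR * mR) : \bar R := unif [set x | S (z.2, (z.1, x))].
pose ar (z : (mR * mR) * mR) : mR * (mR * mR) := (z.1.2, (z.1.1, z.2)).
have mar : measurable_fun setT ar.
  apply/measurable_fun_pairP; split.
    exact: (measurableT_comp measurable_snd measurable_fst).
  apply/measurable_fun_pairP; split; last exact: measurable_snd.
  exact: (measurableT_comp measurable_fst measurable_fst).
have mSar : measurable (ar @^-1` S).
  by rewrite -[X in measurable X]setTI; exact: mar.
have mG : measurable_fun setT G := @measurable_xsection_set _ _ _ _ R unif _ mSar.
have G0 z : 0 <= G z by [].
have mrot : measurable_fun setT (rotation c s : mR * mR -> mR * mR) := measurable_rotation c s.
transitivity (\int[gauss \x gauss]_z G (rotation c s z)).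
  have mGr : measurable_fun setT (fun z : mR * mR => G (rotation c s z)).
    exact: (measurableT_comp mG mrot).
  rewrite [RHS](@fubini_tonelli1 _ _ _ _ _ gauss gauss _ mGr (fun z => G0 _)).
  apply: (etrans (product_measure_xsection _ _ _)); apply: eq_integral => a _.
  pose S' : set (mR * mR) := [set z | S (ar (rotation c s (a, z.1), z.2))].
  have mS' : measurable S'.
    have mf : measurable_fun setT
        (fun z : mR * mR => ar (rotation c s (a, z.1) : mR * mR, z.2)).
      apply: (measurableT_comp mar).
      apply/measurable_fun_pairP; split; last exact: measurable_snd.
      apply: (measurableT_comp mrot).
      by apply/measurable_fun_pairP; split; [exact: measurable_cst|exact: measurable_fst].
    exact: (measurable_preimageT mf mS).
  apply: (etrans (unif_split_unif mS')).
  exact: (etrans (product_measure_xsection _ _ _)).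
apply: (etrans (ge0_integral_gauss_rotation c0 cs mG G0)).
apply: (etrans (@fubini_tonelli2 _ _ _ _ _ gauss gauss _ mG G0)).
apply/esym/(etrans (product_measure_xsection _ _ _)).
apply: eq_integral => q _; apply: (etrans (product_measure_xsection _ _ _)).
by apply: eq_integral.
Qed.

End dynamics.

(** * Scalings, linear combinations and intervals under the Gaussian law *)

Section gaussian_laws.
Local Open Scope ereal_scope.
Context {R : realType}.
Local Notation mR := (measurableTypeR R).
Local Notation gauss := (@gauss R).

(** The case distinction is that of [gaussian_rv]. A negative [s] is covered, because for [s != 0]
    the density depends on [s ^+ 2] only. *)
Lemma gauss_scale (s : R) (B : set mR) : measurable B ->
  gauss [set x | B (s * x)%R] =
  if s == 0%R then \d_(0%R : R) B else normal_prob (0 : R)%R s B.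
Proof.
move=> mB; have [->|s0] := eqVneq s 0%R.
  have [B0|B0] := pselect (B 0%R).
    rewrite (_ : [set x | _] = setT) ?probability_setT ?diracE ?mem_set//.
    by apply/seteqP; split => // x _ /=; rewrite mul0r.
  rewrite (_ : [set x | _] = set0) ?measure0 ?diracE ?memNset//.
  by rewrite -subset0 => x /=; rewrite mul0r.
have msB : measurable ([set x | B (s * x)%R] : set mR).
  apply: (@measurable_preimageT _ _ mR mR (fun x : R => s * x)%R) => //.
  exact: measurable_funM.
rewrite /gauss /normal_prob /=.
rewrite [LHS]integral_mkcond [RHS]integral_mkcond.
have mpdf m r : measurable_fun setT (EFin \o normal_pdf m r : R -> \bar R).
  by apply/measurable_EFinP; exact: measurable_normal_pdf.
have mf : measurable_fun setT ((EFin \o normal_pdf 0 s) \_ B : R -> \bar R).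
  by apply/(measurable_restrictT _ _).1 => //; apply: measurable_funTS.
apply/esym; apply: (etrans (@ge0_integral_affine _ s 0%R _ s0 mf _)).
  by move=> x; rewrite patchE; case: ifP => // _; rewrite lee_fin normal_pdf_ge0.
have mf' : measurable_fun setT ((EFin \o normal_pdf 0 1) \_ [set x | B (s * x)%R] : R -> \bar R).
  by apply/(measurable_restrictT _ _).1 => //; apply: measurable_funTS.
have mg : measurable_fun setT (fun x : R => (EFin \o normal_pdf 0 s) \_ B (s * x + 0)%R).
  exact: (measurableT_comp mf (measurable_affine s 0%R)).
rewrite -ge0_integralZl//; last first.
  by move=> x _; rewrite patchE; case: ifP => // _; rewrite lee_fin normal_pdf_ge0.
apply: eq_integral => x _; rewrite addr0 !patchE.
rewrite (_ : (x \in [set x | B (s * x)%R]) = (s * x \in B)%R); last first.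
  by apply/idP/idP; rewrite !inE.
case: ifP => _; last by rewrite mule0.
rewrite -EFinM; congr EFin; rewrite !normal_pdfE ?oner_neq0//.
rewrite /normal_peak /normal_fun !subr0 expr1n mul1r mulrA; congr (_ * expR _)%R.
  have -> : Num.sqrt (s ^+ 2 * pi *+ 2)%R = (`|s| * Num.sqrt (pi *+ 2))%R.
    by rewrite -mulrnAr sqrtrM ?sqr_ge0// sqrtr_sqr.
  rewrite invfM mulrA.
  by rewrite divff ?mul1r// normr_eq0.
have s2 : (s ^+ 2 != 0)%R by rewrite sqrf_eq0.
by rewrite exprMn; field.
Qed.

Lemma gauss_sym (B : set mR) : measurable B -> gauss [set x | B (- x)%R] = gauss B.
Proof.
move=> mB; rewrite (_ : [set x | _] = [set x | B (-1 * x)%R]); last first.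
  by apply/seteqP; split => x /=; rewrite mulN1r.
rewrite gauss_scale// oppr_eq0 oner_eq0 /gauss /= /normal_prob.
apply: eq_integral => x _; congr EFin.
by rewrite !normal_pdfE ?oppr_eq0 ?oner_eq0// /normal_peak /normal_fun sqrrN.
Qed.

Lemma gauss_set1 (x : R) : gauss [set x] = 0.
Proof.
have := @normal_prob_dominates R 0%R 1%R.
move=> /null_content_dominatesP; apply => //.
exact: lebesgue_measure_set1.
Qed.

Lemma gauss_ge0 : gauss `[0%R, +oo[%classic = 2^-1%:E.
Proof.
have mI : measurable (`[0%R, +oo[%classic : set mR) by exact: measurable_itv.
have mI' : measurable (`]-oo, 0%R]%classic : set mR) by exact: measurable_itv.
have E1 : gauss `]-oo, 0%R]%classic = gauss `[0%R, +oo[%classic.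
  rewrite -(gauss_sym mI); congr (gauss _).
  by apply/seteqP; split => x /=; rewrite !in_itv/= andbT oppr_ge0.
have E2 : gauss `]-oo, 0%R]%classic = gauss (`]-oo, 0%R]%classic `\` [set 0%R]) + 0.
  have m0 : measurable ([set 0%R] : set mR) by exact: measurable_set1.
  apply: (etrans (measureDI gauss mI' m0)); congr (_ + _).
  rewrite (_ : _ `&` [set 0%R] = [set 0%R]); first exact: gauss_set1.
  by apply/seteqP; split => x /=; [case|move=> ->; rewrite in_itv/=].
have E3 : (1 : \bar R) = gauss (setT `\` `[0%R, +oo[%classic) + gauss (setT `&` `[0%R, +oo[%classic).
  by rewrite -(probability_setT gauss); exact: measureDI.
move: E3; rewrite setTI (_ : setT `\` _ = `]-oo, 0%R]%classic `\` [set 0%R]); last first.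
  apply/seteqP; split => x /=.
    move=> [_]; rewrite !in_itv/= andbT => /negP; rewrite -ltNge => x0.
    by split; [exact: ltW|move=> x00; rewrite x00 ltxx in x0].
  move=> []; rewrite !in_itv/= andbT => x0 xn0; split => //.
  by apply/negP; rewrite -ltNge lt_neqAle x0 andbT; exact/eqP.
have -> : gauss (`]-oo, 0%R]%classic `\` [set 0%R]) = gauss `[0%R, +oo[%classic.
  by rewrite -E1 E2 adde0.
have fS : gauss `[0%R, +oo[%classic \is a fin_num by rewrite fin_num_measure.
by rewrite -(fineK fS) -EFinD => -[h]; congr EFin; lra.
Qed.

(** On the positive half-line the density decreases, so on the interval it is at least its value at
    [b]. *)
Lemma gauss_itv_ge (a b : R) : (0 <= a)%R -> (a <= b)%R ->
  (normal_pdf 0 1 b * (b - a))%:E <= gauss `[a, b[%classic.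
Proof.
move=> a0 ab; rewrite /gauss /= /normal_prob.
rewrite EFinM.
have -> : (b - a)%:E = lebesgue_measure `[a, b[%classic.
  rewrite lebesgue_measure_itv/= lte_fin; case: ltP => // ba.
  by rewrite (_ : b = a) ?subrr//; apply/le_anti; rewrite ab ba.
rewrite -integral_cst//; apply: ge0_le_integral => //.
- by move=> x _; rewrite lee_fin normal_pdf_ge0.
- by apply/measurable_EFinP; apply: measurable_funTS; exact: measurable_normal_pdf.
move=> x /=; rewrite in_itv/= => /andP[ax xb].
rewrite lee_fin !normal_pdfE ?oner_eq0//.
rewrite ler_pM2l ?normal_peak_gt0 ?oner_eq0// /normal_fun ler_expR !subr0.
rewrite ler_pM2r ?invr_gt0 ?mulrn_wgt0 ?exprn_gt0//.
by rewrite lerN2 ler_sqr ?nnegrE//; [exact: ltW|exact: le_trans ax|exact: le_trans ab].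
Qed.

(** The rotation with cosine [a / r] and sine [b / r] turns the combination into [r] times the first
    coordinate. *)
Lemma gauss_lincomb (a b : R) (B : set mR) : a != 0%R -> measurable B ->
  (gauss \x gauss) [set z | B (a * z.1 + b * z.2)%R] =
  gauss [set x | B (Num.sqrt (a ^+ 2 + b ^+ 2) * x)%R].
Proof.
move=> a0 mB; set r := Num.sqrt _.
have r2 : (0 < a ^+ 2 + b ^+ 2)%R.
  by rewrite ltr_wpDr ?sqr_ge0// lt_neqAle sqr_ge0 andbT eq_sym sqrf_eq0.
have r0 : (0 < r)%R by rewrite sqrtr_gt0.
have rr : (r ^+ 2 = a ^+ 2 + b ^+ 2)%R by rewrite sqr_sqrtr// ltW.
have mrB : measurable ([set x | B (r * x)%R] : set mR).
  apply: (@measurable_preimageT _ _ mR mR (fun x : R => r * x)%R) => //.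
  exact: measurable_funM.
have mS : measurable ([set x | B (r * x)%R] `*` setT : set (mR * mR)).
  exact: measurableX.
have c0 : (a / r != 0)%R by rewrite mulf_neq0// invr_eq0 gt_eqF.
have cs : ((a / r) ^+ 2 + (b / r) ^+ 2 = 1)%R.
  by rewrite !expr_div_n -mulrDl -rr divff// sqrf_eq0 gt_eqF.
have E : (gauss \x gauss) ([set x | B (r * x)%R] `*` setT) = gauss [set x | B (r * x)%R].
  apply: (etrans (product_measure1E gauss gauss mrB measurableT)).
  rewrite -[RHS]mule1; congr (_ * _); exact: (probability_setT gauss).
rewrite -E -(gauss_rotation c0 cs mS).
congr ((gauss \x gauss) _); apply/seteqP; split => z /=.
  move=> h; split => //; rewrite (_ : (r * _)%R = (a * z.1 + b * z.2)%R)//.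
  by field; rewrite gt_eqF.
move=> [h _]; rewrite (_ : (_ + _)%R = (r * (a / r * z.1 + b / r * z.2))%R)//.
by field; rewrite gt_eqF.
Qed.

Lemma gauss_lincomb_ex (a b : R) : exists r : R, forall B : set mR, measurable B ->
  (gauss \x gauss) [set z | B (a * z.1 + b * z.2)%R] = gauss [set x | B (r * x)%R].
Proof.
(* For [a = 0] the rotation would have cosine 0, which [gauss_rotation] excludes; the combination is
   then a multiple of the second coordinate. *)
have [->|a0] := eqVneq a 0%R; last first.
  by exists (Num.sqrt (a ^+ 2 + b ^+ 2)) => B mB; exact: gauss_lincomb.
exists b => B mB.
have mbB : measurable ([set x | B (b * x)%R] : set mR).
  apply: (@measurable_preimageT _ _ mR mR (fun x : R => b * x)%R) => //.
  exact: measurable_funM.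
rewrite (_ : [set z | _] = setT `*` [set x | B (b * x)%R]).
  apply: (etrans (product_measure1E gauss gauss measurableT mbB)).
  rewrite -[RHS]mul1e; congr (_ * _); exact: (probability_setT gauss).
by apply/seteqP; split => z /=; rewrite mul0r add0r => // -[].
Qed.

End gaussian_laws.

(** * Harris' inequality and approximation by cylinders *)

Section cube_sums.
Context {R : realFieldType}.
Implicit Types (n : nat) (F G p d c : seq bool -> R).

Fixpoint csum n F : R :=
  if n is n'.+1 then
    csum n' (fun b => F (true :: b)) + csum n' (fun b => F (false :: b))
  else F [::].

Lemma eq_csum n F G : (forall b, size b = n -> F b = G b) -> csum n F = csum n G.
Proof.
elim: n F G => [|n IH] F G FG /=; first exact: FG.
by congr (_ + _); apply: IH => b sb; apply: FG; rewrite /= sb.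
Qed.

Lemma le_csum n F G : (forall b, size b = n -> F b <= G b) -> csum n F <= csum n G.
Proof.
elim: n F G => [|n IH] F G FG /=; first exact: FG.
by apply: lerD; apply: IH => b sb; apply: FG; rewrite /= sb.
Qed.

Lemma csumD n F G : csum n (fun b => F b + G b) = csum n F + csum n G.
Proof. by elim: n F G => //= n IH F G; rewrite !IH; ring. Qed.

Lemma csumZ n (a : R) F : csum n (fun b => a * F b) = a * csum n F.
Proof. by elim: n F => //= n IH F; rewrite !IH mulrDr. Qed.

(* Along a coordinate in [J], [d] is constant while [p] and [c] are monotone in
   opposite directions; along any other coordinate [c] is constant. *)
Lemma harris n (J : set nat) p d c :
  (forall b, size b = n -> 0 <= p b) ->
  (forall b b', size b = n -> all2 implb b b' -> p b' <= p b) ->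
  (forall b, size b = n -> 0 <= d b) ->
  (forall b b', size b = n -> size b' = n ->
     (forall i, ~ J i -> nth false b i = nth false b' i) -> d b = d b') ->
  (forall b b', size b = n -> all2 implb b b' -> c b <= c b') ->
  (forall b b', size b = n -> size b' = n ->
     (forall i, J i -> nth false b i = nth false b' i) -> c b = c b') ->
  2 ^+ n * csum n (fun b => p b * d b * c b) <=
  csum n (fun b => p b * d b) * csum n c.
Proof.
elim: n J p d c => [|n IH] J p d c p0 pmono d0 dJ cmono cJ.
  by rewrite /= expr0 mul1r.
have refl (b : seq bool) : all2 implb b b by elim: b => //= x b ->; case: x.
pose J' : set nat := fun i => J i.+1.
have IHx (x : bool) : 2 ^+ n * csum n (fun b => p (x :: b) * d (x :: b) * c (x :: b)) <=
    csum n (fun b => p (x :: b) * d (x :: b)) * csum n (fun b => c (x :: b)).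
  apply: (IH J').
  - by move=> b sb; apply: p0; rewrite /= sb.
  - by move=> b b' sb bb'; apply: pmono; rewrite /= ?sb ?bb'//; case: x.
  - by move=> b sb; apply: d0; rewrite /= sb.
  - by move=> b b' sb sb' bb'; apply: dJ; rewrite /= ?sb ?sb'// => -[|i]//=; exact: bb'.
  - by move=> b b' sb bb'; apply: cmono; rewrite /= ?sb ?bb'//; case: x.
  - by move=> b b' sb sb' bb'; apply: cJ; rewrite /= ?sb ?sb'// => -[|i]//=; exact: bb'.
rewrite [csum n.+1 (fun b => _ * _ * _)]/= [csum n.+1 (fun b => _ * _)]/=.
rewrite [csum n.+1 c]/=.
have := IHx true; have := IHx false.
set S1 := csum n (fun b => _ * d (false :: b) * _); set S2 := csum n (fun b => _ * d (true :: b) * _).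
set A0 := csum n (fun b => _ * d (false :: b)); set A1 := csum n (fun b => _ * d (true :: b)).
set C0 := csum n (fun b => c (false :: b)); set C1 := csum n (fun b => c (true :: b)).
move=> h0 h1; rewrite exprS.
(* Chebyshev's inequality on two points. The induction hypothesis leaves [2 * (A0 * C0 + A1 * C1) <=
   (A0 + A1) * (C0 + C1)], that is [(A0 - A1) * (C0 - C1) <= 0]. If the first coordinate is in [J]
   the factors have opposite signs; otherwise the second one is 0. *)
have [J0|J0] := pselect (J 0%N).
  have AA : A1 <= A0.
    apply: le_csum => b sb; rewrite (_ : d (true :: b) = d (false :: b)).
      rewrite ler_wpM2r//; first by apply: d0; rewrite /= sb.
      by apply: pmono; rewrite /= ?sb// refl.
    by apply: dJ; rewrite /= ?sb// => -[|i].
  have CC : C0 <= C1.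
    by apply: le_csum => b sb; apply: cmono; rewrite /= ?sb// refl.
  nra.
have CC : C0 = C1.
  by apply: eq_csum => b sb; apply: cJ; rewrite /= ?sb// => -[|i].
by rewrite CC in h0 *; nra.
Qed.

End cube_sums.

(** * Approximation of events by finite words of fair bits *)

Section words.
Context d (T : measurableType d) (R : realType) (P : probability T R).
Implicit Types A B C D E : set T.

Let pr A : R := fine (P A).

Let pfin A : measurable A -> P A = (pr A)%:E.
Proof. by move=> mA; rewrite /pr fineK// fin_num_measure. Qed.

Let pr_ge0 A : 0 <= pr A. Proof. by rewrite /pr fine_ge0. Qed.

Let pr_le1 A : measurable A -> pr A <= 1.
Proof. by move=> mA; rewrite -lee_fin -pfin//; exact: probability_le1. Qed.

Let pr_le A B : measurable A -> measurable B -> A `<=` B -> pr A <= pr B.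
Proof.
by move=> mA mB AB; rewrite -lee_fin -!pfin//; apply: le_measure; rewrite ?inE.
Qed.

Let pr_split A B : measurable A -> measurable B ->
  pr A = pr (A `\` B) + pr (A `&` B).
Proof.
move=> mA mB; have mAB := measurableD mA mB; have mIB := measurableI _ _ mA mB.
by apply: EFin_inj; rewrite EFinD -!pfin//; exact: measureDI.
Qed.

Let pr_le2 A B C : measurable A -> measurable B -> measurable C ->
  A `<=` B `|` C -> pr A <= pr B + pr C.
Proof.
move=> mA mB mC ABC; rewrite (pr_split mA mB) addrC; apply: lerD.
  by apply: pr_le; [exact: measurableI|exact: mB|exact: subIsetr].
apply: pr_le => //; first exact: measurableD.
by move=> x [/ABC[]].
Qed.

Variable word : nat -> T -> seq bool.
Hypothesis size_word : forall n w, size (word n w) = n.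
Hypothesis mword : forall n (K : pred (seq bool)), measurable [set w | K (word n w)].
Hypothesis Pword : forall n b, size b = n -> P [set w | word n w == b] = ((2^-1) ^+ n)%:E.
Hypothesis take_word : forall n n' w, (n <= n')%N -> word n w = take n (word n' w).

Let cyl n (K : pred (seq bool)) := [set w | K (word n w)].
Let atom n b := [set w | word n w == b].

Let matom n b : measurable (atom n b).
Proof. exact: (mword n (pred1 b)). Qed.

Let pr_atom n b : size b = n -> pr (atom n b) = 2^-1 ^+ n.
Proof. by move=> sb; rewrite /pr /atom Pword. Qed.

Lemma pr_csum n E : measurable E -> pr E = csum n (fun b => pr (E `&` atom n b)).
Proof.
move=> mE; rewrite /atom.
(* Generalised to an arbitrary measurable word-valued map, since the induction removes the first
   letter and what remains is no longer of the form [word n]. *)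
suff main k (f : T -> seq bool) : (forall w, size (f w) = k) ->
    (forall b, measurable [set w | f w == b]) ->
    pr E = csum k (fun b => pr (E `&` [set w | f w == b])).
  exact: (main n (word n) (size_word n) (matom n)).
elim: k f => [|k IH] f sf mf /=.
  congr pr; apply/esym/setIidl => w _ /=.
  by apply/eqP/size0nil; exact: sf.
have sbf w : size (behead (f w)) = k by rewrite size_behead sf.
have fE w : f w = head false (f w) :: behead (f w).
  by move: (sf w); case: (f w) => //.
have bE b : [set w | behead (f w) == b] =
    [set w | f w == true :: b] `|` [set w | f w == false :: b].
  apply/seteqP; split => w /=.
    rewrite (fE w) /= !eqseq_cons; case: (head false (f w)) => -> /=; by [left|right].
  by case=> /eqP ->.
have mbf b : measurable [set w | behead (f w) == b].
  by rewrite bE; exact: measurableU.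
rewrite (IH _ sbf mbf) -csumD; apply: eq_csum => b sb.
have mEb := measurableI _ _ mE (mbf b).
rewrite (pr_split mEb (mf (false :: b))); congr (_ + _); congr pr.
  apply/seteqP; split => w /=.
    by rewrite (fE w)/= !eqseq_cons; case: (head false (f w)) => -[[Ew ->]]//= /(_ isT).
  by move=> [Ew /eqP ->] /=.
apply/seteqP; split => w /= [].
  by move=> [Ew _] ->.
by move=> Ew /eqP ->.
Qed.

Let symd A B := (A `\` B) `|` (B `\` A).

Let msymd A B : measurable A -> measurable B -> measurable (symd A B).
Proof. by move=> mA mB; apply: measurableU; exact: measurableD. Qed.

(** Asking for all lengths from some [N] on lets several events be approximated at one common
    length. *)
Definition approximable D := measurable D /\ forall e : R, 0 < e ->
  exists N, forall n, (N <= n)%N ->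
    exists K : pred (seq bool), pr (symd D (cyl n K)) <= e.

Lemma approximable_cyl n K : approximable (cyl n K).
Proof.
split; first exact: mword.
move=> e e0; exists n => n' nn'; exists (fun b => K (take n b)).
rewrite (_ : symd _ _ = set0); first by rewrite /pr measure0 ltW.
rewrite -subset0 => w; rewrite /symd /cyl /= -take_word//.
by case=> -[].
Qed.

Lemma approximableC D : approximable D -> approximable (~` D).
Proof.
move=> [mD aD]; split; first exact: measurableC.
move=> e /aD[N HN]; exists N => n /HN[K HK]; exists (predC K).
apply: le_trans HK; apply: pr_le.
- by apply: msymd; [exact: measurableC|exact: mword].
- by apply: msymd => //; exact: mword.
move=> w; rewrite /symd /cyl /= => -[[Dw /negP]|[/negP Kw /contrapT Dw]].
  by rewrite negbK => Kw; right.
by left.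
Qed.

Lemma approximableU A B : approximable A -> approximable B -> approximable (A `|` B).
Proof.
move=> [mA aA] [mB aB]; split; first exact: measurableU.
move=> e e0; have e2 : 0 < e / 2 by rewrite divr_gt0.
have [N HN] := aA _ e2; have [M HM] := aB _ e2.
exists (maxn N M) => n; rewrite geq_max => /andP[/HN[K HK] /HM[L HL]].
exists (predU K L); rewrite (splitr e); apply: le_trans (lerD HK HL).
apply: pr_le2; try by apply: msymd => //; exact: mword.
  by apply: msymd; [exact: measurableU|exact: mword].
move=> w; rewrite /symd /cyl /= => -[[[Aw|Bw] /negP]|[/orP[Kw|Lw] /not_orP[nA nB]]].
- by rewrite negb_or => /andP[/negP Kw _]; left; left.
- by rewrite negb_or => /andP[_ /negP Kw]; right; left.
- by left; right.
- by right; right.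
Qed.

Lemma approximable_lim D : measurable D ->
  (forall e : R, 0 < e -> exists2 D', approximable D' & pr (symd D D') <= e) ->
  approximable D.
Proof.
move=> mD aD; split => // e e0; have e2 : 0 < e / 2 by rewrite divr_gt0.
have [D' [mD' aD'] DD'] := aD _ e2.
have [N HN] := aD' _ e2; exists N => n /HN[K HK]; exists K.
rewrite (splitr e); apply: le_trans (lerD DD' HK).
apply: pr_le2; try by apply: msymd => //; exact: mword.
move=> w; rewrite /symd /cyl /= => -[[Dw Kw]|[Kw Dw]];
  have [D'w|D'w] := pselect (D' w).
- by right; left.
- by left; left.
- by left; right.
- by right; right.
Qed.

Lemma approximable_bigcup (F : (set T)^nat) :
  (forall i, approximable (F i)) -> approximable (\bigcup_i F i).
Proof.
move=> aF; have mF i : measurable (F i) by case: (aF i).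
have mU : measurable (\bigcup_i F i) by exact: bigcupT_measurable.
apply: approximable_lim => // e e0.
pose U n := \big[setU/set0]_(i < n) F i.
have aU n : approximable (U n).
  rewrite /U; elim: n => [|n IH].
    rewrite big_ord0 (_ : set0 = cyl 0 pred0); first exact: approximable_cyl.
    by apply/seteqP; split.
  by rewrite big_ord_recr; exact: approximableU.
have UE : \bigcup_i F i = \bigcup_n U n.
  apply/seteqP; split => w [i _ Fw].
    by exists i.+1 => //; rewrite /U big_ord_recr; right.
  move: Fw; rewrite /U -bigcup_mkord => -[j _ Fj]; by exists j.
have mUn n : measurable (U n) by case: (aU n).
have cv : P (U n) @[n --> \oo] --> P (\bigcup_i F i).
  rewrite UE; apply: nondecreasing_cvg_mu => //; first by rewrite -UE.
  by move=> a b ab; apply/subsetPset; exact: subset_bigsetU.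
have lt : (P (\bigcup_i F i) - e%:E < P (\bigcup_i F i))%E.
  by rewrite pfin// -EFinB lte_fin ltrBlDr ltrDl.
have [n Hn] := cvge_ex_gt cv lt.
exists (U n) => //.
have sub : U n `<=` \bigcup_i F i by rewrite UE => w Uw; exists n.
rewrite (_ : symd _ _ = \bigcup_i F i `\` U n); last first.
  apply/seteqP; split => w; last by left.
  by case=> // -[/sub].
have := pr_split mU (mUn n); rewrite (setIidr sub) => E.
by move: Hn; rewrite !pfin// -EFinB lte_fin; lra.
Qed.

Lemma approximable_sigma_algebra : sigma_algebra setT approximable.
Proof.
split.
- rewrite (_ : set0 = cyl 0 pred0); first exact: approximable_cyl.
  by apply/seteqP; split.
- by move=> A; rewrite setTD; exact: approximableC.
- exact: approximable_bigcup.
Qed.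

(* On most atoms of the partition by [word n], an approximable event is nearly
   independent of any other event. *)
Lemma approximable_csum D : approximable D -> forall e : R, 0 < e ->
  exists N, forall n, (N <= n)%N -> forall E, measurable E ->
    csum n (fun b => `|pr (E `&` D `&` atom n b) -
                       pr (E `&` atom n b) * (2 ^+ n * pr (D `&` atom n b))|) <= e.
Proof.
move=> [mD aD] e e0; have e2 : 0 < e / 2 by rewrite divr_gt0.
have [N HN] := aD _ e2; exists N => n /HN[K HK] E mE.
have mC : measurable (cyl n K) by exact: mword.
set S := symd D (cyl n K) in HK; have mS : measurable S by exact: msymd.
rewrite (splitr e); apply: le_trans (lerD HK HK).
rewrite -/(pr S) (pr_csum n mS) -csumD; apply: le_csum => b sb.
set a := atom n b; have ma : measurable a by exact: matom.
(* Replacing [D] by the cylinder costs at most the part of the symmetric difference inside the atom.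
   Over all atoms these costs add up to [pr S <= e / 2], and the estimate is spent twice. *)
have key F : measurable F ->
    `|pr (F `&` D `&` a) - pr (F `&` cyl n K `&` a)| <= pr (S `&` a).
  move=> mF; have mSa := measurableI _ _ mS ma.
  have m1 := measurableI _ _ (measurableI _ _ mF mD) ma.
  have m2 := measurableI _ _ (measurableI _ _ mF mC) ma.
  rewrite distrC ler_distlC; apply/andP; split.
    rewrite lerBlDr; apply: pr_le2 => // w [[Fw Cw] aw].
    have [Dw|Dw] := pselect (D w); first by left.
    by right; split => //; right.
  apply: pr_le2 => // w [[Fw Dw] aw].
  have [Cw|Cw] := pselect (cyl n K w); first by left.
  by right; split => //; left.
(* On a single atom the cylinder is everything or nothing, so the conditional probability of [D]
   there is close to [(K b)%:R]. *)
have cylE F : F `&` cyl n K `&` a = if K b then F `&` a else set0.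
  case: ifPn => Kb; apply/seteqP; split => w //=; rewrite /a /atom /cyl /=.
  - by move=> [[Fw _] aw].
  - by move=> [Fw /eqP aw]; split; [split => //; rewrite aw|exact/eqP].
  - by move=> [[Fw +] /eqP aw]; rewrite aw (negbTE Kb).
have k1 := key _ mE; have k2 := key _ measurableT.
rewrite !setTI in k2; rewrite !cylE in k1.
have {}k2 : `|pr (D `&` a) - (K b)%:R * 2^-1 ^+ n| <= pr (S `&` a).
  move: k2; rewrite -[cyl n K `&` a](setTI) setIA cylE.
  by case: (K b); rewrite ?setTI ?pr_atom// ?mul1r// /pr measure0 mul0r.
have {}k1 : `|pr (E `&` D `&` a) - (K b)%:R * pr (E `&` a)| <= pr (S `&` a).
  by move: k1; case: (K b); rewrite ?mul1r// mul0r /pr measure0.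
have pos : (0 : R) < 2 ^+ n by rewrite exprn_gt0.
have inv : (2 ^+ n * 2^-1 ^+ n = 1 :> R) by rewrite -exprMn divff// expr1n.
have Ea : pr (E `&` a) <= 2^-1 ^+ n.
  rewrite -(pr_atom sb); apply: pr_le => //; exact: measurableI.
have k3 : `|(K b)%:R - 2 ^+ n * pr (D `&` a)| * 2^-1 ^+ n <= pr (S `&` a).
  rewrite distrC -[X in _ * X]ger0_norm ?exprn_ge0// -normrM mulrBl.
  by rewrite mulrAC inv mul1r.
have -> : pr (E `&` D `&` a) - pr (E `&` a) * (2 ^+ n * pr (D `&` a)) =
  (pr (E `&` D `&` a) - (K b)%:R * pr (E `&` a)) +
  ((K b)%:R - 2 ^+ n * pr (D `&` a)) * pr (E `&` a) by ring.
apply: le_trans (ler_normD _ _) _; apply: lerD => //.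
rewrite normrM (ger0_norm (pr_ge0 _)); apply: le_trans k3.
by rewrite ler_wpM2l.
Qed.

(** Harris' inequality is applied to the masses of [E] on the atoms and to the conditional
    probabilities of [D] and [C] given the word. Only [D] and [C] are approximated by cylinders; [E]
    is to be the event that the state is nonnegative, which is not a function of the signs. *)
Lemma approximable_neg_corr (J : set nat) E D C :
  measurable E -> approximable D -> approximable C ->
  (forall n b b', size b = n -> all2 implb b b' ->
    pr (E `&` atom n b') <= pr (E `&` atom n b)) ->
  (forall n b b', size b = n -> size b' = n ->
    (forall i, ~ J i -> nth false b i = nth false b' i) ->
    pr (D `&` atom n b) = pr (D `&` atom n b')) ->
  (forall n b b', size b = n -> all2 implb b b' ->
    pr (C `&` atom n b) <= pr (C `&` atom n b')) ->
  (forall n b b', size b = n -> size b' = n ->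
    (forall i, J i -> nth false b i = nth false b' i) ->
    pr (C `&` atom n b) = pr (C `&` atom n b')) ->
  pr (E `&` D `&` C) <= pr (E `&` D) * pr C.
Proof.
move=> mE aD aC Emono DJ Cmono CJ.
have mD := aD.1; have mC := aC.1; have mED := measurableI _ _ mE mD.
(* Two thirds of [e] are spent in [h1], on [D] given [E] and on [C] given the intersection of [E]
   and [D]; the last third is spent in [h2]. *)
apply/ler_addgt0Pr => e e0; have e3 : 0 < e / 3 by rewrite divr_gt0.
have [N HN] := approximable_csum aD e3; have [M HM] := approximable_csum aC e3.
pose n := maxn N M.
have {}HN := HN n (leq_maxl _ _) E mE; have {}HM := HM n (leq_maxr _ _) _ mED.
pose p b := pr (E `&` atom n b).
pose f b := 2 ^+ n * pr (D `&` atom n b); pose c b := 2 ^+ n * pr (C `&` atom n b).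
have pos : (0 : R) < 2 ^+ n by rewrite exprn_gt0.
have inv : (2 ^+ n * 2^-1 ^+ n = 1 :> R) by rewrite -exprMn divff// expr1n.
have mI A b : measurable A -> measurable (A `&` atom n b).
  by move=> mA; exact: measurableI.
have f0 b : 0 <= f b by rewrite mulr_ge0// ltW.
have c0 b : 0 <= c b by rewrite mulr_ge0// ltW.
have c1 b : size b = n -> c b <= 1.
  move=> sb; rewrite -inv ler_pM2l// -(pr_atom sb); apply: pr_le => //.
  exact: mI.
have H : 2 ^+ n * csum n (fun b => p b * f b * c b) <=
    csum n (fun b => p b * f b) * csum n c.
  apply: (harris (J := J)).
  - by move=> b _; exact: pr_ge0.
  - by move=> b b' sb bb'; exact: Emono.
  - by move=> b _; exact: f0.
  - by move=> b b' sb sb' bb'; rewrite /f (DJ n b b').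
  - by move=> b b' sb bb'; rewrite ler_pM2l//; exact: Cmono.
  - by move=> b b' sb sb' bb'; rewrite /c (CJ n b b').
have cE : csum n c = 2 ^+ n * pr C by rewrite csumZ -pr_csum.
rewrite cE mulrCA ler_pM2l// in H.
have h1 : pr (E `&` D `&` C) <= csum n (fun b => p b * f b * c b) + (e / 3 + e / 3).
  rewrite (pr_csum n); last exact: measurableI.
  apply: le_trans (lerD (lexx _) (lerD HN HM)); rewrite -!csumD.
  apply: le_csum => b sb; rewrite -/(p b) -/(f b) -/(c b).
  set x := pr (E `&` D `&` C `&` _); set y := pr (E `&` D `&` _).
  have /ler_normlP[_ k1] := lexx `|x - y * c b|.
  have /ler_normlP[_ k2] := lexx `|y - p b * f b|.
  have := c0 b; have := c1 b sb; have := normr_ge0 (y - p b * f b).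
  set u := `|y - _|; set v := `|x - _|.
  rewrite -/u in k2; rewrite -/v in k1.
  nra.
have h2 : csum n (fun b => p b * f b) <= pr (E `&` D) + e / 3.
  rewrite (pr_csum n mED); apply: le_trans (lerD (lexx _) HN).
  rewrite -csumD; apply: le_csum => b sb; rewrite -/(p b) -/(f b).
  set y := pr (E `&` D `&` _).
  have /ler_normlP[k2 _] := lexx `|y - p b * f b|.
  by rewrite opprB in k2; lra.
have := pr_le1 mC; have := pr_ge0 C.
nra.
Qed.

(** Kolmogorov's argument: [E] is nearly determined by a long word and yet independent of every
    word, hence of itself. [approximable_csum] with [D := E] bounds [pr E * (1 - pr E)] by any
    [e > 0]. *)
Lemma approximable_trivial E : approximable E ->
  (forall n b, size b = n -> pr (E `&` atom n b) = 2^-1 ^+ n * pr E) ->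
  P E = 0%E \/ P E = 1%E.
Proof.
move=> aE indep; have mE := aE.1; rewrite pfin//.
suff : pr E * (1 - pr E) <= 0.
  have := pr_ge0 E; have := pr_le1 mE => h1 h0 h.
  have : pr E * (1 - pr E) = 0 by apply/le_anti; rewrite h mulr_ge0// subr_ge0.
  move=> /eqP; rewrite mulf_eq0 subr_eq0 => /orP[|]/eqP; first by move=> ->; left.
  by move=> <-; right.
apply/ler_addgt0Pr => e e0; rewrite add0r.
have [N HN] := approximable_csum aE e0.
apply: le_trans (HN N (leqnn N) E mE).
have inv : (2 ^+ N * 2^-1 ^+ N = 1 :> R) by rewrite -exprMn divff// expr1n.
rewrite mulrC {2}(pr_csum N mE) -csumZ; apply: le_csum => b sb.
rewrite setIid; have := indep N b sb; set x := pr (E `&` _) => ib.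
have -> : 2 ^+ N * x = pr E by rewrite ib mulrA inv mul1r.
by rewrite (le_trans _ (ler_norm _))//; lra.
Qed.

End words.

(** * From level sets to expectations *)

Section staircase.
Context {R : realType}.

(** For [y >= 0] this is the minimum of [N] and the integer part of [y]. As a sum of indicators of
    half-lines it is suited to inequalities known for level sets. *)
Definition count_upto (N : nat) (y : R) : R := \sum_(i < N) (i.+1%:R <= y)%R%:R.

Lemma count_uptoS N y : count_upto N.+1 y = count_upto N y + (N.+1%:R <= y)%R%:R.
Proof. by rewrite /count_upto big_ord_recr. Qed.

Lemma count_upto_le N y : count_upto N y <= N%:R.
Proof.
elim: N => [|N IH]; first by rewrite /count_upto big_ord0.
rewrite count_uptoS -[in leRHS]natr1; apply: lerD => //.
by rewrite lern1; case: (_ <= y).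
Qed.

Lemma count_upto_le0 N y : y <= 0 -> count_upto N y = 0.
Proof.
move=> y0; by apply: big1 => i _; rewrite leNgt (le_lt_trans y0).
Qed.

Lemma count_upto_ley N y : 0 <= y -> count_upto N y <= y.
Proof.
move=> y0; elim: N => [|N IH]; first by rewrite /count_upto big_ord0.
rewrite count_uptoS; case: (leP N.+1%:R y) => [Ny|_]; last by rewrite mulr0n addr0.
by rewrite (le_trans _ Ny)// mulr1n -[leRHS]natr1 lerD2r count_upto_le.
Qed.

Lemma count_upto_full N y : N%:R <= y -> count_upto N y = N%:R.
Proof.
elim: N => [|N IH] Ny; first by rewrite /count_upto big_ord0.
rewrite count_uptoS Ny IH ?natr1//; apply: le_trans Ny; rewrite ler_nat.
exact: leqnSn.
Qed.

Lemma count_upto_ge N y : y <= N%:R -> y - 1 <= count_upto N y.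
Proof.
elim: N => [|N IH] yN.
  by rewrite /count_upto big_ord0; lra.
rewrite count_uptoS; have [h|h] := leP y N%:R.
  by rewrite (le_trans (IH h))// lerDl ler0n.
rewrite (count_upto_full (ltW h)) -[leLHS]addr0; apply: lerD; last exact: ler0n.
by move: yN; rewrite -natr1; lra.
Qed.

(* Nondecreasing step function: [x] clamped to [-k-1, k+1] and rounded down to
   a multiple of [1/(k+1)]. *)
Definition stair (k : nat) (x : R) : R :=
  count_upto (2 * k.+1 ^ 2) (k.+1%:R * (x + k.+1%:R)) / k.+1%:R - k.+1%:R.

Lemma stair_near k x : `|x| <= k.+1%:R -> `|stair k x - x| <= k.+1%:R^-1.
Proof.
rewrite ler_norml => /andP[x1 x2]; set K : R := k.+1%:R.
have K0 : 0 < K by rewrite ltr0n.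
set y := K * (x + K).
have y0 : 0 <= y by rewrite mulr_ge0//; rewrite -/K in x1; lra.
(* The window [[-K, K]] has length [2 * K] and the steps have height [1 / K], hence [2 * K ^+ 2]
   steps. *)
have yN : y <= (2 * k.+1 ^ 2)%:R.
  by rewrite natrM natrX -/K /y; rewrite -/K in x2; nra.
have u := @count_upto_ley (2 * k.+1 ^ 2) y y0.
have l := count_upto_ge yN.
rewrite /stair -/K -/y; set c := count_upto _ _ in u l *.
have -> : c / K - K - x = (c - y) / K by rewrite /y; field; rewrite gt_eqF.
have Ki : 0 < K^-1 by rewrite invr_gt0.
rewrite normrM (ger0_norm (ltW Ki)) -[leRHS]mul1r (ler_pM2r Ki) ler_norml.
by apply/andP; split; lra.
Qed.

Lemma stair_le k x : `|stair k x| <= `|x| + 1.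
Proof.
set K : R := k.+1%:R; have K0 : 0 < K by rewrite ltr0n.
have K1 : 1 <= K by rewrite ler1n.
have [xK|xK] := leP `|x| K.
  have h := stair_near xK.
  rewrite -[stair k x](subrK x); apply: le_trans (ler_normD _ _) _.
  by rewrite addrC lerD2l (le_trans h)// invf_le1.
suff -> : `|stair k x| = K by rewrite (le_trans (ltW xK))// lerDl.
have [x0|x0] := leP 0 x.
  rewrite ger0_norm// in xK.
  rewrite /stair count_upto_full.
    rewrite natrM natrX -/K (_ : 2%:R * K ^+ 2 / K - K = K) ?ger0_norm ?ltW//.
    by field; rewrite gt_eqF.
  by rewrite natrM natrX -/K; nra.
rewrite ltr0_norm// in xK.
have yn : K * (x + K) <= 0 by nra.
by rewrite /stair -/K (count_upto_le0 _ yn) mul0r sub0r normrN gtr0_norm.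
Qed.

Lemma stair_cvg x : stair k x @[k --> \oo] --> x.
Proof.
apply/cvgrPdist_le => e e0.
have h1 : \forall k \near \oo, (k.+1%:R^-1 : R) <= e.
  near=> k; rewrite invf_ple ?posrE ?ltr0n//.
  near: k; exists (Num.truncn e^-1).+1 => // k /= hk.
  apply: ltW; apply: (lt_le_trans (truncnS_gt _)).
  by rewrite ler_nat (leq_trans hk).
near=> k; rewrite distrC; apply: le_trans (stair_near _) _.
  near: k; exists (Num.truncn `|x|).+1 => // k /= hk.
  apply: ltW; apply: (lt_le_trans (truncnS_gt _)).
  by rewrite ler_nat (leq_trans hk).
by near: k.
Unshelve. all: by end_near. Qed.

End staircase.

Section negative_correlation.
Context d (T : measurableType d) (R : realType) (P : probability T R).
Implicit Types f g : T -> R.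

Let bdd f := measurable_fun setT f /\ exists M, forall w, `|f w| <= M.

Let bdd_integrable f : bdd f -> P.-integrable setT (EFin \o f).
Proof.
move=> [mf [M fM]]; apply: measurable_bounded_integrable => //.
  exact: (le_lt_trans (probability_le1 P measurableT) (ltry _)).
by exists M; split; rewrite ?num_real// => M' MM' w _ /=; exact: le_trans (fM w) (ltW MM').
Qed.

Let bddD f g : bdd f -> bdd g -> bdd (fun w => f w + g w).
Proof.
move=> [mf [M fM]] [mg [N gN]]; split; first exact: measurable_funD.
by exists (M + N) => w; apply: le_trans (ler_normD _ _) _; exact: lerD.
Qed.

Let bddM f g : bdd f -> bdd g -> bdd (fun w => f w * g w).
Proof.
move=> [mf [M fM]] [mg [N gN]]; split; first exact: measurable_funM.
by exists (M * N) => w; rewrite normrM ler_pM.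
Qed.

Let bdd_cst (c : R) : bdd (fun=> c).
Proof. by split; [exact: measurable_cst|exists `|c|]. Qed.

Let ind_ge (u : R) (x : R) : R := (u <= x)%R%:R.

Let bdd_ind f u : measurable_fun setT f -> bdd (fun w => ind_ge u (f w)).
Proof.
move=> mf; split.
  rewrite (_ : (fun w => _) = \1_[set w | u <= f w]).
    apply: measurable_indic; rewrite (_ : [set w | _] = f @^-1` `[u, +oo[).
      exact: measurable_preimageT.
    by apply/seteqP; split => w /=; rewrite in_itv/= andbT.
  apply/funext => w; rewrite indicE; congr (nat_of_bool _)%:R.
  by apply/idP/idP; rewrite inE.
by exists 1 => w; rewrite ger0_norm ?ler0n// lern1; case: (_ <= _).
Qed.

Let iR f : R := \int[P]_w f w.

Let iRD f g : bdd f -> bdd g -> iR (fun w => f w + g w) = iR f + iR g.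
Proof. by move=> bf bg; apply: RintegralD => //; exact: bdd_integrable. Qed.

Let iRZ (c : R) f : bdd f -> iR (fun w => c * f w) = c * iR f.
Proof. by move=> bf; apply: RintegralZl => //; exact: bdd_integrable. Qed.

Let iR_cst c : iR (fun=> c) = c.
Proof.
rewrite /iR Rintegral_cst// -[RHS]mulr1; congr (_ * _).
exact: (congr1 fine (probability_setT P)).
Qed.

Let nc f g := bdd f /\ bdd g /\ iR (fun w => f w * g w) <= iR f * iR g.

Let nc_sym f g : nc f g -> nc g f.
Proof.
move=> [bf [bg h]]; split => //; split => //; rewrite [leRHS]mulrC.
by rewrite (_ : (fun w => _) = (fun w => f w * g w))//; apply/funext => w; rewrite mulrC.
Qed.

Let ncD f f' g : nc f g -> nc f' g -> nc (fun w => f w + f' w) g.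
Proof.
move=> [bf [bg h]] [bf' [_ h']]; split; first exact: bddD.
split => //; rewrite (_ : (fun w => (f w + f' w) * g w) = (fun w => f w * g w + f' w * g w)); last first.
  by apply/funext => w; rewrite mulrDl.
rewrite !iRD//; [|exact: bddM..].
by rewrite mulrDl lerD.
Qed.

Let ncZ c f g : 0 <= c -> nc f g -> nc (fun w => c * f w) g.
Proof.
move=> c0 [bf [bg h]]; split; first exact: (bddM (bdd_cst c) bf).
split => //; rewrite (_ : (fun w => c * f w * g w) = (fun w => c * (f w * g w))); last first.
  by apply/funext => w; rewrite mulrA.
rewrite !iRZ//; last exact: bddM.
by rewrite -mulrA ler_wpM2l.
Qed.

Let nc_cst c g : bdd g -> nc (fun=> c) g.
Proof.
by move=> bg; split; [exact: bdd_cst|split => //; rewrite iRZ// iR_cst].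
Qed.

(** [stair k] is a nonnegative combination of level indicators plus a constant, and [nc] is stable
    under such combinations in its first argument. *)
Let nc_stair k f g : (forall u, nc (fun w => ind_ge u (f w)) g) ->
  nc (fun w => stair k (f w)) g.
Proof.
move=> H; have bg : bdd g by case: (H 0) => _ [].
pose K : R := k.+1%:R; have K0 : 0 < K by rewrite ltr0n.
rewrite (_ : (fun w => _) = (fun w => K^-1 * count_upto (2 * k.+1 ^ 2) (K * (f w + K)) + (- K))); last first.
  by apply/funext => w; rewrite /stair mulrC.
apply: ncD; last exact: nc_cst.
apply: ncZ; first by rewrite invr_ge0 ltW.
elim: (2 * k.+1 ^ 2)%N => [|N IH].
  rewrite (_ : (fun w => _) = fun=> 0); first exact: nc_cst.
  by apply/funext => w; rewrite /count_upto big_ord0.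
rewrite (_ : (fun w => _) = (fun w => count_upto N (K * (f w + K)) +
    ind_ge (N.+1%:R / K - K) (f w))); first exact: ncD.
apply/funext => w; rewrite count_uptoS; congr (_ + _).
by rewrite /ind_ge lerBlDr ler_pdivrMr// mulrC.
Qed.

(** The inequality for level sets passes to the staircases in each argument, and then to [f] and [g]
    by dominated convergence. The product of the staircases is dominated by [(|f| + 1) * (|g| + 1)],
    whose expansion is integrable because [f * g] is. *)
Lemma expectation_neg_corr f g :
  P.-integrable setT (EFin \o f) -> P.-integrable setT (EFin \o g) ->
  P.-integrable setT (fun w => (f w * g w)%:E) ->
  (forall u v, fine (P ([set w | u <= f w] `&` [set w | v <= g w])) <=
     fine (P [set w | u <= f w]) * fine (P [set w | v <= g w])) ->
  ('E_P[fun w => (f w * g w)%R] <= 'E_P[f] * 'E_P[g])%E.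
Proof.
move=> If Ig Ifg H.
have mf : measurable_fun setT f by exact/measurable_EFinP/(measurable_int _ If).
have mg : measurable_fun setT g by exact/measurable_EFinP/(measurable_int _ Ig).
have mge (h : T -> R) (u : R) : measurable_fun setT h -> measurable [set w | u <= h w].
  move=> mh; rewrite (_ : [set w | _] = h @^-1` `[u, +oo[).
    exact: measurable_preimageT.
  by apply/seteqP; split => w /=; rewrite in_itv/= andbT.
have indE A : measurable A -> iR (\1_A) = fine (P A).
  by move=> mA; rewrite /iR /Rintegral integral_indic// setIT.
have ind_geE (h : T -> R) u : (fun w => ind_ge u (h w)) = \1_[set w | u <= h w].
  by apply/funext => w; rewrite indicE /ind_ge; congr (nat_of_bool _)%:R;
    apply/idP/idP; rewrite inE.
have nc_ind u v : nc (fun w => ind_ge u (f w)) (fun w => ind_ge v (g w)).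
  split; first exact: bdd_ind; split; first exact: bdd_ind.
  rewrite !ind_geE (indE _ (mge _ _ mf)) (indE _ (mge _ _ mg)).
  rewrite (_ : (fun w => _) = \1_([set w | u <= f w] `&` [set w | v <= g w])).
    by rewrite indE//; apply: measurableI; exact: mge.
  by apply/funext => w; rewrite indicI -!ind_geE.
have nc_k k : nc (fun w => stair k (f w)) (fun w => stair k (g w)).
  by apply: nc_stair => u; apply/nc_sym/nc_stair => v; apply/nc_sym/nc_ind.
have ms (h : T -> R) k : (h = f \/ h = g) -> measurable_fun setT (fun w => stair k (h w)).
  have [[m1 _] [[m2 _] _]] := nc_k k.
  by case=> ->.
have cvg1 (h : T -> R) : P.-integrable setT (EFin \o h) ->
    (forall k, measurable_fun setT (fun w => stair k (h w))) ->
    (\int[P]_w (stair k (h w))%:E)%E @[k --> \oo] --> (\int[P]_w (h w)%:E)%E.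
  move=> Ih mh.
  have [] := @dominated_convergence _ _ _ P setT measurableT
     (fun k w => (stair k (h w))%:E) (EFin \o h) (fun w => (`|h w| + 1)%:E).
  - by move=> k; exact/measurable_EFinP/mh.
  - exact: measurable_int Ih.
  - by apply: aeW => w _ /=; apply: cvg_EFin; [exact: nearW|exact: stair_cvg].
  - rewrite (_ : (fun w => _) = (fun w => `|(h w)%:E| + 1)%E)//.
    apply: integrableD => //; first exact: (integrable_abse Ih).
    exact: finite_measure_integrable_cst.
  - by apply: aeW => w k _; rewrite /= lee_fin stair_le.
  - by [].
have cvg2 : (\int[P]_w (stair k (f w) * stair k (g w))%:E)%E @[k --> \oo] -->
    (\int[P]_w (f w * g w)%:E)%E.
  have [] := @dominated_convergence _ _ _ P setT measurableT
     (fun k w => (stair k (f w) * stair k (g w))%:E) (fun w => (f w * g w)%:E)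
     (fun w => (`|f w * g w| + (`|f w| + (`|g w| + 1)))%:E).
  - move=> k; apply/measurable_EFinP; apply: measurable_funM; apply: ms; by [left|right].
  - exact: measurable_int Ifg.
  - apply: aeW => w _ /=; apply: cvg_EFin; first exact: nearW.
    by apply: cvgM; exact: stair_cvg.
  - rewrite (_ : (fun w => _) = (fun w => `|(f w * g w)%:E| + (`|(f w)%:E| + (`|(g w)%:E| + 1)))%E)//.
    apply: integrableD => //; first exact: (integrable_abse Ifg).
    apply: integrableD => //; first exact: (integrable_abse If).
    apply: integrableD => //; first exact: (integrable_abse Ig).
    exact: finite_measure_integrable_cst.
  - apply: aeW => w k _; rewrite /= lee_fin !normrM.
    have := stair_le k (f w); have := stair_le k (g w) => h1 h2.
    have := normr_ge0 (stair k (f w)); have := normr_ge0 (stair k (g w)).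
    by nra.
  - by [].
have fE := integrable_fin_num measurableT If.
have gE := integrable_fin_num measurableT Ig.
rewrite unlock.
have cvg3 : ((\int[P]_w (stair k (f w))%:E) * (\int[P]_w (stair k (g w))%:E))%E
    @[k --> \oo] --> ((\int[P]_w (f w)%:E) * (\int[P]_w (g w)%:E))%E.
  apply: cvgeM; first exact: mule_def_fin.
    by apply: cvg1 => // k; apply: ms; left.
  by apply: cvg1 => // k; apply: ms; right.
rewrite -(cvg_lim _ cvg2)// -(cvg_lim _ cvg3)//; apply: lee_lim.
- by apply/cvg_ex; eexists; exact: cvg2.
- by apply/cvg_ex; eexists; exact: cvg3.
apply: nearW => k.
have [b1 [b2 h]] := nc_k k; have b12 := bddM b1 b2.
have fin1 (k1 : T -> R) : bdd k1 -> (\int[P]_w (k1 w)%:E = (iR k1)%:E)%E.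
  by move=> bh; rewrite /iR /Rintegral fineK// integrable_fin_num//; exact: bdd_integrable.
by rewrite /= !fin1// -EFinM lee_fin.
Qed.

End negative_correlation.

Lemma fine_measure_subD d (T : measurableType d) (R : realType)
    (m : probability T R) (A Q C : set T) :
  measurable A -> measurable Q -> measurable C -> C `<=` Q -> A `<=` Q `\` C ->
  fine (m A) <= fine (m Q) - fine (m C).
Proof.
move=> mA mQ mC CQ AQC.
have mQC : measurable (Q `\` C) by exact: measurableD.
have fin B : measurable B -> m B \is a fin_num by move=> mB; rewrite fin_num_measure.
have AQ : (m A <= m (Q `\` C))%E by apply: le_measure; rewrite ?inE.
have EQ : m Q = (m (Q `\` C) + m C)%E.
  by rewrite -{2}(setIidr CQ); exact: measureDI.
move: EQ AQ; rewrite -(fineK (fin _ mA)) -(fineK (fin _ mQ)) -(fineK (fin _ mC)).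
by rewrite -(fineK (fin _ mQC)) -EFinD lee_fin => -[E1] E2 /=; lra.
Qed.

(** * The Gaussian process *)

Section gaussian_chain.
Local Open Scope ereal_scope.
Context {R : realType}.
Local Notation mR := (measurableTypeR R).
Local Notation gauss := (@gauss R).
Context d (T : measurableType d) (P : probability T R).
(* [s] is the state, and stage [m] maps the sample point [w] to an output [h m w]
   and a new sample point [t m w], which is independent of it. *)
Variables (h : nat -> T -> R) (t : nat -> T -> T) (s : T -> R) (co si : nat -> R).

Definition head_tail (m : nat) (w : T) : mR * T := (h m w, t m w).

Hypothesis mht : forall m, measurable_fun setT (head_tail m).
Hypothesis Pht : forall m (S : set (mR * T)), measurable S ->
  P (head_tail m @^-1` S) = (gauss \x P) S.
Hypothesis ms : measurable_fun setT (s : T -> mR).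
Hypothesis Ps : forall B : set mR, measurable B -> P (s @^-1` B) = gauss B.
Hypothesis sE : forall m w, s w = (co m * s (t m w) - si m * h m w)%R.
Hypothesis co_gt0 : forall m, (0 < co m)%R.
Hypothesis si_gt0 : forall m, (0 < si m)%R.
Hypothesis cosi : forall m, (co m ^+ 2 + si m ^+ 2 = 1)%R.

(** The starting stage [m] is a parameter because, after one output, the chain continues as one
    started at [m.+1]; this is the induction step of most lemmas below. *)
Fixpoint out (m n : nat) (w : T) : R :=
  if n is n'.+1 then out m.+1 n' (t m w) else h m w.

Lemma mh m : measurable_fun setT (h m : T -> mR).
Proof. exact: (measurableT_comp measurable_fst (mht m)). Qed.

Lemma mt m : measurable_fun setT (t m).
Proof. exact: (measurableT_comp measurable_snd (mht m)). Qed.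

Lemma mout m n : measurable_fun setT (out m n : T -> mR).
Proof.
elim: n m => [|n IH] m; first exact: mh.
exact: (measurableT_comp (IH m.+1) (mt m)).
Qed.

Lemma P_head_tail m (S : set (mR * T)) : measurable S ->
  P [set w | S (h m w, t m w)] = \int[gauss]_u P [set w | S (u, w)].
Proof. by move=> mS; apply: (etrans (Pht m mS)); exact: product_measure_xsection. Qed.

(* The linear combination [c0 * s + \sum_j c_j * out m j], see [linE], arranged as
   a combination of independent terms. *)
Fixpoint lin (m : nat) (c0 : R) (c : seq R) (w : T) : R :=
  if c is a :: c' then
    ((a - c0 * si m) * h m w + lin m.+1 (c0 * co m) c' (t m w))%R
  else (c0 * s w)%R.

Lemma linE m c0 c w :
  lin m c0 c w = (c0 * s w + \sum_(j < size c) c`_j * out m j w)%R.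
Proof.
elim: c m c0 w => [|a c IH] m c0 w /=; first by rewrite big_ord0 addr0.
rewrite IH big_ord_recl/= (sE m w); ring.
Qed.

Lemma measurable_lin m c0 c : measurable_fun setT (lin m c0 c : T -> mR).
Proof.
elim: c m c0 => [|a c IH] m c0 /=.
  by apply: measurable_funM => //; exact: ms.
apply: measurable_funD.
  by apply: measurable_funM => //; exact: mh.
exact: (measurableT_comp (IH _ _) (mt m)).
Qed.

(** The head term of [lin] is independent of the rest, which is a multiple of a Gaussian by
    induction; [gauss_lincomb_ex] merges the two. *)
Lemma lin_gauss m c0 c : exists r : R, forall B : set mR, measurable B ->
  P (lin m c0 c @^-1` B) = gauss [set x | B (r * x)%R].
Proof.
have mMr (r : R) : measurable_fun [set: mR] (fun x : R => r * x : mR)%R.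
  exact: measurable_funM.
elim: c m c0 => [|a c IH] m c0.
  exists c0 => B mB; rewrite -Ps//; exact: (measurable_preimageT (mMr c0) mB).
have [r Hr] := IH m.+1 (c0 * co m)%R.
have [r' Hr'] := gauss_lincomb_ex (a - c0 * si m)%R r.
exists r' => B mB; rewrite -Hr'//.
pose L := lin m.+1 (c0 * co m)%R c.
pose S : set (mR * T) := [set z | B ((a - c0 * si m) * z.1 + L z.2)%R].
have mS : measurable S.
  apply: (@measurable_preimageT _ _ (mR * T)%type mR (fun z => (a - c0 * si m) * z.1 + L z.2)%R) => //.
  apply: measurable_funD.
    by apply: measurable_funM => //; exact: measurable_fst.
  exact: (measurableT_comp (measurable_lin _ _ _) measurable_snd).
apply: (etrans (P_head_tail m mS)).
apply/esym/(etrans (product_measure_xsection _ _ _))/esym.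
apply: eq_integral => u _.
apply: (Hr [set v | B ((a - c0 * si m) * u + v)%R]).
apply: (@measurable_preimageT _ _ mR mR (fun v => (a - c0 * si m) * u + v)%R) => //.
by apply: measurable_funD.
Qed.

(** * Words of signs, their independence and their effect on the state *)

Fixpoint word (m n : nat) (w : T) : seq bool :=
  if n is n'.+1 then (0 <= h m w)%R :: word m.+1 n' (t m w) else [::].

Fixpoint shift (m n : nat) (w : T) : T :=
  if n is n'.+1 then shift m.+1 n' (t m w) else w.

Lemma size_word m n w : size (word m n w) = n.
Proof. by elim: n m w => //= n IH m w; rewrite IH. Qed.

Lemma nth_word m n j w : (j < n)%N -> nth false (word m n w) j = (0 <= out m j w)%R.
Proof. by elim: n m j w => // n IH m [|j] w //=; rewrite ltnS; exact: IH. Qed.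

Lemma out_shift m n j w : out m (n + j) w = out (m + n) j (shift m n w).
Proof.
by elim: n m w => [|n IH] m w /=; rewrite ?add0n ?addn0// IH addnS.
Qed.

Lemma measurable_shift m n : measurable_fun setT (shift m n).
Proof.
elim: n m => [|n IH] m /=; first exact: measurable_id.
exact: (measurableT_comp (IH m.+1) (mt m)).
Qed.

Let msign (x : bool) : measurable ([set u : R | (0 <= u)%R = x] : set mR).
Proof.
case: x.
- rewrite (_ : [set u | _] = `[0%R, +oo[%classic); last first.
    by apply/seteqP; split => u /=; rewrite in_itv/= andbT.
  exact: measurable_itv.
- rewrite (_ : [set u | _] = `]-oo, 0%R[%classic); last first.
    apply/seteqP; split => u /=; rewrite in_itv/= ltNge; first by move=> ->.
    by move/negbTE.
  exact: measurable_itv.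
Qed.

Let gauss_sign (x : bool) : gauss [set u : R | (0 <= u)%R = x] = 2^-1%:E.
Proof.
have E : gauss [set u : R | (0 <= u)%R = true] = 2^-1%:E.
  rewrite -gauss_ge0; congr (gauss _).
  by apply/seteqP; split => u /=; rewrite in_itv/= andbT.
case: x => //.
rewrite (_ : [set u | _] = ~` [set u : R | (0 <= u)%R = true]).
  apply: (etrans (probability_setC gauss (msign true))).
  by rewrite E -EFinB; congr EFin; lra.
by apply/seteqP; split => u /=; case: (0 <= u)%R.
Qed.

Lemma measurable_word m n (b : seq bool) : measurable [set w | word m n w = b].
Proof.
elim: n m b => [|n IH] m [|x b] /=.
- by rewrite (_ : [set w | _] = setT)//; apply/seteqP.
- by rewrite (_ : [set w | _] = set0)//; apply/seteqP; split.
- by rewrite (_ : [set w | _] = set0)//; apply/seteqP; split.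
rewrite (_ : [set w | _] = h m @^-1` [set u | (0 <= u)%R = x] `&`
    t m @^-1` [set w | word m.+1 n w = b]); last first.
  by apply/seteqP; split => w /= [-> ->].
apply: measurableI.
  exact: (@measurable_preimageT _ _ T mR (h m) _ (mh m) (msign x)).
exact: (measurable_preimageT (mt m) (IH _ _)).
Qed.

(** Each stage emits a fair sign independent of the next sample point, which has law [P] again. *)
Lemma word_shift_indep m n (b : seq bool) (A : set T) : size b = n ->
  measurable A ->
  P ([set w | word m n w = b] `&` shift m n @^-1` A) = ((2^-1) ^+ n)%:E * P A.
Proof.
move=> sb mA; elim: n m b sb => [|n IH] m [|x b] //= => [_|[sb]].
  rewrite expr0 mul1e; congr (P _).
  by apply/seteqP; split => w //= [].
pose B := [set w | word m.+1 n w = b] `&` shift m.+1 n @^-1` A.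
have mB : measurable B.
  apply: measurableI; first exact: measurable_word.
  exact: (measurable_preimageT (measurable_shift _ _) mA).
rewrite (_ : _ `&` _ = head_tail m @^-1` ([set u : R | (0 <= u)%R = x] `*` B)).
  have mS : measurable ([set u : R | (0 <= u)%R = x] `*` B : set (mR * T)).
    exact: measurableX.
  apply: (etrans (Pht m mS)); apply: (etrans (product_measure1E gauss P (msign x) mB)).
  rewrite exprS EFinM -muleA -(IH m.+1 b sb); congr (_ * _).
  exact: gauss_sign.
apply/seteqP; split => w /=.
  by move=> [[-> wb] wA]; split.
by move=> [/= -> [/= -> ?]].
Qed.

Lemma P_word m n (b : seq bool) : size b = n ->
  P [set w | word m n w = b] = ((2^-1) ^+ n)%:E.
Proof.
move=> sb; have := word_shift_indep m sb measurableT.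
by rewrite preimage_setT setIT probability_setT mule1.
Qed.

Let level (m n : nat) (b : seq bool) (a : R) : \bar R :=
  P ([set w | a <= s w]%R `&` [set w | word m n w = b]).

Let ms_ge a : measurable [set w | a <= s w]%R.
Proof.
rewrite (_ : [set w | _] = s @^-1` `[a, +oo[%classic); last first.
  by apply/seteqP; split => w /=; rewrite in_itv/= andbT.
by apply: (@measurable_preimageT _ _ T mR s _ ms); exact: measurable_itv.
Qed.

Let mlevel m n b a : measurable ([set w | a <= s w]%R `&` [set w | word m n w = b]).
Proof. by apply: measurableI => //; exact: measurable_word. Qed.

Let level_le m n b a a' : (a <= a')%R -> level m n b a' <= level m n b a.
Proof.
move=> aa; apply: le_measure; rewrite ?inE//.
by move=> w [/= sw ww]; split => //=; exact: le_trans sw.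
Qed.

(** Conditioning on the first output [u]: by [sE], the state is at least [a] exactly when the next
    state is at least [(a + si m * u) / co m]. *)
Let level_rec m n x b a : level m n.+1 (x :: b) a =
  \int[gauss]_(u in [set u | (0 <= u)%R = x]) level m.+1 n b ((a + si m * u) / co m)%R.
Proof.
pose S : set (mR * T) := [set z | (0 <= z.1)%R = x] `&`
  ([set z | a <= co m * s z.2 - si m * z.1]%R `&` [set z | word m.+1 n z.2 = b]).
have mS : measurable S.
  apply: measurableI.
    exact: (@measurable_preimageT _ _ (mR * T)%type mR fst _ measurable_fst (msign x)).
  apply: measurableI; last first.
    exact: (@measurable_preimageT _ _ (mR * T)%type T snd _ measurable_snd (measurable_word m.+1 n b)).
  rewrite (_ : [set z | _] = (fun z : mR * T => co m * s z.2 - si m * z.1)%R @^-1` `[a, +oo[%classic); last first.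
    by apply/seteqP; split => w /=; rewrite in_itv/= andbT.
  apply: (@measurable_preimageT _ _ (mR * T)%type mR _ _ _ (measurable_itv _)).
  apply: measurable_funB.
    apply: measurable_funM => //; exact: (measurableT_comp ms measurable_snd).
  by apply: measurable_funM => //; exact: measurable_fst.
transitivity (P [set w | S (h m w, t m w)]).
  congr (P _); apply/seteqP; split => w; rewrite /S /=.
    by move=> [+ [-> ->]]; rewrite (sE m w).
  by rewrite -(sE m w); move=> [-> [? ->]].
apply: (etrans (P_head_tail m mS)).
rewrite [RHS]integral_mkcond; apply: eq_integral => u _.
rewrite patchE; have [ux|ux] := eqVneq (0 <= u)%R x.
  rewrite mem_set//; congr (P _); apply/seteqP; split => w; rewrite /S /=.
    by move=> [_ [h1 h2]]; split => //; rewrite ler_pdivrMr// mulrC; lra.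
  move=> [h1 h2]; split => //; split => //.
  by move: h1; rewrite ler_pdivrMr// mulrC; lra.
rewrite memNset; last exact/eqP.
rewrite (_ : [set w | _] = set0) ?measure0//.
by rewrite -subset0 => w; rewrite /S/= => -[/eqP]; rewrite (negbTE ux).
Qed.

Let mlevel_fun m n b : measurable_fun [set: mR] (level m n b : mR -> \bar R).
Proof.
pose A : set (mR * T) := [set z | z.1 <= s z.2]%R `&` [set z | word m n z.2 = b].
suff mA : measurable A by exact: (@measurable_xsection_set _ _ mR T R P A mA).
apply: measurableI; last first.
  exact: (@measurable_preimageT _ _ (mR * T)%type T snd _ measurable_snd (measurable_word m n b)).
rewrite (_ : [set z | _] = (fun z : mR * T => s z.2 - z.1)%R @^-1` `[0%R, +oo[%classic); last first.
  by apply/seteqP; split => w /=; rewrite in_itv/= andbT subr_ge0.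
apply: (@measurable_preimageT _ _ (mR * T)%type mR _ _ _ (measurable_itv _)).
apply: measurable_funB; last exact: measurable_fst.
exact: (measurableT_comp ms measurable_snd).
Qed.

Let mlevel_affine m m' n b a :
  measurable_fun [set: mR] (fun u : R => level m' n b ((a + si m * u) / co m)%R).
Proof.
rewrite (_ : (fun u => _) = level m' n b \o (fun u => si m / co m * u + a / co m)%R).
  exact: (measurableT_comp (mlevel_fun _ _ _) (measurable_affine _ _)).
by apply/funext => u /=; congr level; field; rewrite gt_eqF.
Qed.

(* Raising a sign among the outputs lowers [s], since [s] is
   [co * s (tail) - si * head] with [si > 0]. *)
Lemma level_mono m n b b' a : all2 implb b b' ->
  P ([set w | a <= s w]%R `&` [set w | word m n w = b']) <=
  P ([set w | a <= s w]%R `&` [set w | word m n w = b]).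
Proof.
rewrite -!/(level _ _ _ _); elim: n m b b' a => [|n IH] m [|x b] [|x' b'] a //=.
  move=> _; rewrite /level (_ : _ `&` _ = set0) ?measure0//.
  by rewrite -subset0 => w /= [].
case/andP => xx' bb'; rewrite !level_rec.
have lvl0 k v r : 0 <= level k n v r by [].
have mono y : \int[gauss]_(u in [set u | (0 <= u)%R = y])
      level m.+1 n b' ((a + si m * u) / co m)%R <=
    \int[gauss]_(u in [set u | (0 <= u)%R = y])
      level m.+1 n b ((a + si m * u) / co m)%R.
  apply: ge0_le_integral => //.
  - by apply: measurable_funTS; exact: mlevel_affine.
  - by apply: measurable_funTS; exact: mlevel_affine.
  - by move=> u _; exact: IH.
case: x' xx'; case: x => //= _; try exact: mono.
(* The remaining case is that of a first sign raised from false to true. The level at [u = 0] bounds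
   the integrand from above on [u >= 0] and from below on [u < 0], and both half-lines have mass
   1/2. *)
apply: le_trans (mono _) _.
have cst_int y : \int[gauss]_(u in [set u | (0 <= u)%R = y])
    level m.+1 n b (a / co m)%R = level m.+1 n b (a / co m)%R * 2^-1%:E.
  apply: (etrans (integral_cst gauss (msign y) _)); congr (_ * _); exact: gauss_sign.
apply: (@le_trans _ _ (level m.+1 n b (a / co m)%R * 2^-1%:E)).
- rewrite -(cst_int true); apply: ge0_le_integral => //.
  + by apply: measurable_funTS; exact: mlevel_affine.
  move=> u u0; apply: level_le.
  by rewrite ler_pM2r ?invr_gt0// lerDl mulr_ge0// ltW.
- rewrite -(cst_int false); apply: ge0_le_integral => //.
  + by apply: measurable_funTS; exact: mlevel_affine.
  move=> u /negbT; rewrite -ltNge => u0; apply: level_le.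
  by rewrite ler_pM2r ?invr_gt0// gerDl pmulr_rle0// ltW.
Qed.

(* [- eps m n] is the covariance of [s] and [out m n]. *)
Fixpoint eps (m n : nat) : R :=
  if n is n'.+1 then (co m * eps m.+1 n')%R else si m.

Lemma eps_itv m n : (0 < eps m n < 1)%R.
Proof.
have si1 k : (si k < 1)%R.
  by have := cosi k; have := si_gt0 k; have := co_gt0 k; nra.
have co1 k : (co k < 1)%R.
  by have := cosi k; have := si_gt0 k; have := co_gt0 k; nra.
elim: n m => [|n IH] m /=; first by rewrite si_gt0 si1.
have /andP[e0 e1] := IH m.+1.
by rewrite mulr_gt0//=; have := co_gt0 m; have := co1 m; nra.
Qed.

(** The pair is written with two independent Gaussians, its covariance being [- eps m n]. In the
    induction step the pair of the next stage is represented in this way, and at a fixed value [y]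
    of the output the first head and the independent part of the next state merge into one
    Gaussian. *)
Lemma law_s_out m n (S : set (mR * mR)) : measurable S ->
  P [set w | S (s w, out m n w)] =
  (gauss \x gauss) [set z | S (Num.sqrt (1 - eps m n ^+ 2) * z.1 - eps m n * z.2, z.2)%R].
Proof.
elim: n m S => [|n IH] m S mS.
  have -> : (1 - eps m 0 ^+ 2)%R = (co m ^+ 2)%R by rewrite /= -(cosi m) addrK.
  rewrite sqrtr_sqr gtr0_norm//.
  pose S1 : set (mR * T) := [set z | S (co m * s z.2 - si m * z.1, z.1)%R].
  have mS1 : measurable S1.
    apply: (@measurable_preimageT _ _ (mR * T)%type (mR * mR)%type _ _ _ mS).
    apply/measurable_fun_pairP; split; last exact: measurable_fst.
    apply: measurable_funB.
      by apply: measurable_funM => //; exact: (measurableT_comp ms measurable_snd).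
    by apply: measurable_funM => //; exact: measurable_fst.
  transitivity (P [set w | S1 (h m w, t m w)]).
    by congr (P _); apply/seteqP; split => w; rewrite /S1 /= -(sE m w).
  apply: (etrans (P_head_tail m mS1)).
  apply/esym; apply: (etrans (product_measure_ysection gauss gauss _)).
    apply: (@measurable_preimageT _ _ (mR * mR)%type (mR * mR)%type _ _ _ mS).
    apply/measurable_fun_pairP; split; last exact: measurable_snd.
    by apply: measurable_funB; apply: measurable_funM.
  apply: eq_integral => u _; apply/esym.
  have mB : measurable ([set v | S (co m * v - si m * u, u)%R] : set mR).
    apply: (@measurable_preimageT _ _ mR (mR * mR)%type _ _ _ mS).
    apply/measurable_fun_pairP; split; last exact: measurable_cst.
    by apply: measurable_funB => //; exact: measurable_funM.
  exact: (Ps mB).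
set e' := eps m.+1 n; set k' := Num.sqrt (1 - e' ^+ 2).
have /andP[e0 e1] : (0 < e' < 1)%R := eps_itv m.+1 n.
have k'2 : (k' ^+ 2 = 1 - e' ^+ 2)%R.
  by rewrite sqr_sqrtr// subr_ge0 expr_le1// ltW.
have mpair (a b : mR * mR -> mR) : measurable_fun setT a -> measurable_fun setT b ->
    measurable [set z | S (a z, b z)].
  move=> ma mb; apply: (@measurable_preimageT _ _ (mR * mR)%type (mR * mR)%type _ _ _ mS).
  by apply/measurable_fun_pairP; split.
pose S1 : set (mR * T) := [set z | S (co m * s z.2 - si m * z.1, out m.+1 n z.2)%R].
have mS1 : measurable S1.
  apply: (@measurable_preimageT _ _ (mR * T)%type (mR * mR)%type _ _ _ mS).
  apply/measurable_fun_pairP; split; last exact: (measurableT_comp (mout _ _) measurable_snd).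
  apply: measurable_funB.
    by apply: measurable_funM => //; exact: (measurableT_comp ms measurable_snd).
  by apply: measurable_funM => //; exact: measurable_fst.
transitivity (P [set w | S1 (h m w, t m w)]).
  by congr (P _); apply/seteqP; split => w; rewrite /S1 /= -(sE m w).
apply: (etrans (P_head_tail m mS1)).
pose f (z : mR * mR) := gauss [set x | S (co m * (k' * x - e' * z.2) - si m * z.1, z.2)%R].
have mf : measurable_fun setT f.
  apply: (@measurable_xsection_set _ _ (mR * mR)%type mR R gauss
    [set z | S (co m * (k' * z.2 - e' * z.1.2) - si m * z.1.1, z.1.2)%R]).
  apply: (@measurable_preimageT _ _ (mR * mR * mR)%type (mR * mR)%type _ _ _ mS).
  have m11 : measurable_fun setT (fun z : mR * mR * mR => z.1.1).
    exact: (measurableT_comp measurable_fst measurable_fst).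
  have m12 : measurable_fun setT (fun z : mR * mR * mR => z.1.2).
    exact: (measurableT_comp measurable_snd measurable_fst).
  apply/measurable_fun_pairP; split; last exact: m12.
  apply: measurable_funB; apply: measurable_funM => //.
  by apply: measurable_funB; apply: measurable_funM.
transitivity (\int[gauss]_u \int[gauss]_y f (u, y)).
  apply: eq_integral => u _.
  have mSu : measurable [set z : mR * mR | S (co m * z.1 - si m * u, z.2)%R].
    apply: mpair; last exact: measurable_snd.
    by apply: measurable_funB => //; apply: measurable_funM.
  apply: (etrans (IH m.+1 _ mSu)).
  apply: (etrans (product_measure_ysection gauss gauss _)) => //.
  apply: mpair; last exact: measurable_snd.
  apply: measurable_funB => //; apply: measurable_funM => //.
  by apply: measurable_funB; apply: measurable_funM.
apply: (etrans (@fubini_tonelli _ _ _ _ _ gauss gauss _ mf _)) => //.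
apply/esym; apply: (etrans (product_measure_ysection gauss gauss _)).
  apply: mpair; last exact: measurable_snd.
  by apply: measurable_funB; apply: measurable_funM.
apply: eq_integral => y _; apply/esym.
pose B : set mR := [set v | S (v - co m * e' * y, y)%R].
have mB : measurable B.
  apply: (@measurable_preimageT _ _ mR (mR * mR)%type _ _ _ mS).
  apply/measurable_fun_pairP; split; last exact: measurable_cst.
  by apply: measurable_funB.
(* The merged variance is [si m ^+ 2 + co m ^+ 2 * (1 - e' ^+ 2)], that is
   [1 - (co m * e') ^+ 2]. *)
transitivity ((gauss \x gauss) [set z | B (- si m * z.1 + co m * k' * z.2)%R]).
  apply/esym/(etrans (product_measure_xsection _ _ _)).
  apply: eq_integral => u _; congr (gauss _); apply/seteqP.
  by split => x; rewrite /B /f /=; congr (S (_, _)); ring.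
have si0 : (- si m != 0)%R by rewrite oppr_eq0 gt_eqF.
apply: (etrans (gauss_lincomb _ si0 mB)).
have -> : ((- si m) ^+ 2 + (co m * k') ^+ 2 = 1 - eps m n.+1 ^+ 2)%R.
  rewrite sqrrN exprMn k'2 /= -/e' exprMn.
  have -> : (si m ^+ 2 = 1 - co m ^+ 2)%R by rewrite -(cosi m) addrC addKr.
  by ring.
by [].
Qed.

(** In the independent coordinates of [law_s_out] the event lies in the positive quadrant, of mass
    1/4, and misses the rectangle [C] with sides [[0, e[] and [[1, 2[]. On these sides the density
    is at least its value at 1, as [e < 1], and at 2. *)
Lemma joint_positive m n :
  (fine (P ([set w | 0 <= s w]%R `&` [set w | 0 <= out m n w]%R)) <=
   4^-1 - normal_pdf 0 1 1 * normal_pdf 0 1 2 * eps m n)%R.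
Proof.
set e := eps m n; have /andP[e0 e1] : (0 < e < 1)%R := eps_itv m n.
pose gg : probability (mR * mR)%type R := (gauss \x gauss)%E.
have mI (i : interval R) : measurable ([set` i] : set mR) by exact: measurable_itv.
pose Q : set (mR * mR) := `[0%R, +oo[%classic `*` `[0%R, +oo[%classic.
pose C : set (mR * mR) := `[0%R, e[%classic `*` `[1%R, 2%R[%classic.
have mQ : measurable Q by exact: measurableX.
have mC : measurable C by exact: measurableX.
set k := Num.sqrt (1 - e ^+ 2).
have k0 : (0 < k)%R by rewrite sqrtr_gt0 subr_gt0 expr_lt1// ltW.
have k1 : (k <= 1)%R.
  rewrite -[leRHS]sqrtr1 ler_wsqrtr// gerBl sqr_ge0//.
pose A : set (mR * mR) := [set z | 0 <= k * z.1 - e * z.2]%R `&` [set z | 0 <= z.2]%R.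
have mA : measurable A.
  apply: measurableI.
    rewrite (_ : [set z | _] = (fun z : mR * mR => k * z.1 - e * z.2 : mR)%R @^-1` `[0%R, +oo[%classic).
      apply: (@measurable_preimageT _ _ (mR * mR)%type mR); last exact: mI.
      by apply: measurable_funB; apply: measurable_funM.
    by apply/seteqP; split => z /=; rewrite in_itv/= andbT.
  rewrite (_ : [set z | _] = (snd : mR * mR -> mR) @^-1` `[0%R, +oo[%classic).
    by apply: (@measurable_preimageT _ _ (mR * mR)%type mR); [exact: measurable_snd|exact: mI].
  by apply/seteqP; split => z /=; rewrite in_itv/= andbT.
have PA : P ([set w | 0 <= s w]%R `&` [set w | 0 <= out m n w]%R) = gg A.
  pose S : set (mR * mR) := [set z | 0 <= z.1]%R `&` [set z | 0 <= z.2]%R.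
  have mS : measurable S.
    rewrite (_ : S = Q); first by [].
    by apply/seteqP; split => z; rewrite /S /Q /= !in_itv/= !andbT.
  exact: (law_s_out m n mS).
(* [k * x - e * y < 0] on the rectangle [C], as [k <= 1]. *)
have AQC : A `<=` Q `\` C.
  move=> [x y]; rewrite /A /Q /C /= !in_itv/= !andbT => -[kxy y0].
  have x0 : (0 <= x)%R by rewrite -(pmulr_rge0 _ k0); nra.
  split => // -[/andP[_ xe] /andP[y1 _]].
  have : (k * x <= x)%R by rewrite ler_piMl.
  nra.
have gQ : gg Q = (4^-1)%:E.
  apply: (etrans (product_measure1E gauss gauss (mI _) (mI _))).
  transitivity ((2^-1)%:E * (2^-1)%:E : \bar R)%E; last by rewrite -EFinM; congr EFin; lra.
  by congr (_ * _); exact: gauss_ge0.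
have gC : (normal_pdf 0 1 1 * normal_pdf 0 1 2 * e)%:E <= gg C.
  have -> : gg C = gauss `[0%R, e[%classic * gauss `[1%R, 2%R[%classic.
    exact: (product_measure1E gauss gauss (mI _) (mI _)).
  have h1 : (normal_pdf 0 1 1 * e)%:E <= gauss `[0%R, e[%classic.
    apply: le_trans (gauss_itv_ge (lexx 0%R) (ltW e0)).
    rewrite subr0 lee_fin ler_pM2r// !normal_pdfE ?oner_eq0//.
    rewrite ler_pM2l ?normal_peak_gt0 ?oner_eq0// /normal_fun ler_expR !subr0.
    rewrite ler_pM2r ?invr_gt0 ?mulrn_wgt0 ?exprn_gt0//.
    by rewrite lerN2 ler_sqr ?nnegrE//; exact: ltW.
  have h2 : (normal_pdf 0 1 2)%:E <= gauss `[1%R, 2%R[%classic.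
    have := @gauss_itv_ge R 1 2 ler01 _; rewrite (_ : (2 - 1 = 1)%R); last lra.
    by rewrite mulr1; apply; lra.
  rewrite (_ : (_ * _ * e)%R = (normal_pdf 0 1 1 * e * normal_pdf 0 1 2)%R); last by ring.
  rewrite EFinM; apply: lee_pmul => //; rewrite lee_fin ?mulr_ge0 ?normal_pdf_ge0//.
  exact: ltW.
have CQ : C `<=` Q.
  move=> [x y]; rewrite /Q /C /= !in_itv/= !andbT.
  by move=> [/andP[-> _] /andP[y1 _]]; split => //; exact: le_trans y1.
rewrite PA; apply: (le_trans (@fine_measure_subD _ _ _ gg _ _ _ mA mQ mC CQ AQC)).
rewrite gQ lerD2l lerN2 -lee_fin fineK//; exact: fin_num_measure.
Qed.

Lemma measurable_word_pred m n (K : pred (seq bool)) :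
  measurable [set w | K (word m n w)].
Proof.
elim: n m K => [|n IH] m K /=.
  case KE: (K [::]).
    by rewrite (_ : [set w | _] = setT)//; apply/seteqP.
  by rewrite (_ : [set w | _] = set0)//; apply/seteqP; split.
rewrite (_ : [set w | _] =
    (h m @^-1` [set u | (0 <= u)%R = true] `&`
     t m @^-1` [set w | K (true :: word m.+1 n w)]) `|`
    (h m @^-1` [set u | (0 <= u)%R = false] `&`
     t m @^-1` [set w | K (false :: word m.+1 n w)])); last first.
  apply/seteqP; split => w /=; first by case: (0 <= h m w)%R => Kw; [left|right].
  by case=> -[-> ].
have mS x : measurable (h m @^-1` [set u | (0 <= u)%R = x]).
  exact: (@measurable_preimageT _ _ T mR (h m) _ (mh m) (msign x)).
have mK x : measurable (t m @^-1` [set w | K (x :: word m.+1 n w)]).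
  exact: (measurable_preimageT (mt m) (IH _ (fun b => K (x :: b)))).
by apply: measurableU; apply: measurableI.
Qed.

Lemma take_word m n n' w : (n <= n')%N -> word m n w = take n (word m n' w).
Proof.
elim: n m n' w => [|n IH] m [|n'] w //=.
by rewrite ltnS => nn'; rewrite (IH _ n').
Qed.

Let atomE m n b : [set w | word m n w == b] = [set w | word m n w = b].
Proof. by apply/seteqP; split => w /= /eqP. Qed.

Let Patom n b : size b = n ->
  P [set w | word 0 n w == b] = ((2^-1) ^+ n)%:E.
Proof. by move=> sb; rewrite atomE P_word. Qed.

Let sword n w : size (word 0 n w) = n. Proof. exact: size_word. Qed.

Let mword n (K : pred (seq bool)) : measurable [set w | K (word 0 n w)].
Proof. exact: measurable_word_pred. Qed.

Let tword n n' w : (n <= n')%N -> word 0 n w = take n (word 0 n' w).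
Proof. exact: take_word. Qed.

Lemma shift_preserving m n (A : set T) : measurable A ->
  P (shift m n @^-1` A) = P A.
Proof.
move=> mA; elim: n m => [|n IH] m //=.
have mB := measurable_preimageT (measurable_shift m.+1 n) mA.
rewrite -(IH m.+1).
have mS : measurable (setT `*` (shift m.+1 n @^-1` A) : set (mR * T)).
  exact: measurableX.
rewrite (_ : _ @^-1` A = head_tail m @^-1` (setT `*` (shift m.+1 n @^-1` A))).
  apply: (etrans (Pht m mS)).
  apply: (etrans (product_measure1E gauss P measurableT mB)).
  rewrite -[RHS]mul1e; congr (_ * _); exact: (probability_setT gauss).
by apply/seteqP; split => w //= -[].
Qed.

(** * The Gaussian process, its threshold process and its events *)

Definition gproc (i : nat) (w : T) : R := if i is n.+1 then out 0 n w else s w.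

Lemma mgproc i : measurable_fun setT (gproc i : T -> R).
Proof. by case: i => [|n]; [exact: ms|exact: mout]. Qed.

Definition gprocRV (i : nat) : {RV P >-> R} :=
  HB.pack (gproc i) (isMeasurableFun.Build _ _ _ _ (gproc i) (mgproc i)).

Lemma gproc_gaussian : gaussian_process gprocRV.
Proof.
move=> n k _ c.
pose N := (\max_(i < n) k i)%N.
(* Coefficients are regrouped by time index, so that the combination runs over all indices up to the
   largest one and becomes a [lin]. *)
pose a j : R := (\sum_(i < n | k i == j) c i)%R.
have E w : (\sum_(i < n) c i * gprocRV (k i) w =
    lin 0 (a 0%N) (mkseq (fun j => a j.+1) N) w)%R.
  rewrite linE size_mkseq.
  under [in RHS]eq_bigr => j _ do rewrite nth_mkseq//.
  transitivity (\sum_(j < N.+1) a j * gproc j w)%R; last by rewrite big_ord_recl.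
  under [RHS]eq_bigr => j _ do rewrite /a mulr_suml big_mkcond.
  rewrite exchange_big; apply: eq_bigr => i _ /=.
  have kN : (k i < N.+1)%N by rewrite ltnS /N; exact: leq_bigmax.
  rewrite (bigD1 (Ordinal kN))//= eqxx big1 ?addr0// => j.
  case: ifPn => // /eqP kj /negP[]; apply/eqP/val_inj => /=; by rewrite kj.
have [r Hr] := lin_gauss 0 (a 0%N) (mkseq (fun j => a j.+1) N).
exists 0%R, r => B mB.
rewrite -(gauss_scale r mB) -(Hr B mB); congr (P _).
by apply/seteqP; split => w /=; rewrite E.
Qed.

Let mge i : measurable [set w | 0 <= gproc i w]%R.
Proof.
rewrite (_ : [set w | _] = gproc i @^-1` `[0%R, +oo[%classic); last first.
  by apply/seteqP; split => w /=; rewrite in_itv/= andbT.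
by apply: (@measurable_preimageT _ _ T mR _ _ (mgproc i)); exact: measurable_itv.
Qed.

Definition threshold (i : nat) : {RV P >-> R} :=
  HB.pack (\1_[set w | 0 <= gproc i w]%R : T -> R)
    (isMeasurableFun.Build _ _ _ _ (\1_[set w | 0 <= gproc i w]%R : T -> R)
       (measurable_indic (mge i))).

Lemma threshold_process : gaussian_threshold_process threshold.
Proof. by exists gprocRV, (fun=> 0%R); split; [exact: gproc_gaussian|]. Qed.

Lemma thresholdE i w : threshold i w = ((0 <= gproc i w)%R%:R)%R.
Proof.
rewrite /= indicE; congr (nat_of_bool _)%:R%R.
by apply/idP/idP; rewrite inE.
Qed.

(* The signs of the outputs, with the first [size b] of them replaced by [b]. *)
Definition tail_bits (b : seq bool) (w : T) (i : nat) : R :=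
  if (i < size b)%N then (nth false b i)%:R
  else (0 <= out (size b) (i - size b) w)%R%:R.

Lemma tail_bits_word n w :
  tail_bits [::] w = tail_bits (word 0 n w) (shift 0 n w).
Proof.
apply/funext => i; rewrite /tail_bits /= subn0 size_word.
case: ltnP => [hin|hni]; first by rewrite nth_word.
by rewrite -[in LHS](subnKC hni) out_shift add0n.
Qed.

Let csig : set (set (nat -> R)) :=
  sigma_family (fun (i : nat) (x : nat -> R) => x i) setT.

Let csig_sigma_algebra : sigma_algebra setT csig.
Proof. exact: smallest_sigma_algebra. Qed.

(** Stated for an arbitrary sigma-algebra [Q], as it serves three times: for measurable sets, for
    [approx] and for [csig] itself. *)
Let csig_preimage (U : Type) (phi : U -> nat -> R) (Q : set (set U)) :
  sigma_algebra setT Q ->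
  (forall i B, measurable B -> Q [set u | B (phi u i)]) ->
  forall S, csig S -> Q (phi @^-1` S).
Proof.
move=> sQ gQ S cS; rewrite -[phi @^-1` S]setTI.
apply: (@smallest_sub _ (sigma_algebra setT) _ _ (sigma_algebra_image phi sQ) _ S cS).
move=> _ [i _ [B mB <-]]; rewrite /image_set_system /= setTI setTI.
exact: gQ.
Qed.

Let msign_fun m n : measurable_fun setT (fun w => (0 <= out m n w)%R%:R : R).
Proof.
rewrite (_ : (fun w => _) = \1_[set w | 0 <= out m n w]%R); last first.
  by apply/funext => w; rewrite indicE; congr (nat_of_bool _)%:R; apply/idP/idP; rewrite inE.
apply: measurable_indic.
rewrite (_ : [set w | _] = out m n @^-1` `[0%R, +oo[%classic); last first.
  by apply/seteqP; split => w /=; rewrite in_itv/= andbT.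
by apply: (@measurable_preimageT _ _ T mR _ _ (mout m n)); exact: measurable_itv.
Qed.

Let mevent b S : csig S -> measurable [set w | S (tail_bits b w)].
Proof.
apply: (@csig_preimage _ (tail_bits b) measurable (@sigma_algebra_measurable _ T)).
move=> i B mB; rewrite /tail_bits; case: ltnP => _.
  have [hB|hB] := pselect (B (nth false b i)%:R).
    by rewrite (_ : [set w | _] = setT)//; apply/seteqP; split.
  by rewrite (_ : [set w | _] = set0)//; apply/seteqP; split.
exact: (@measurable_preimageT _ _ T mR _ _ (msign_fun _ _) mB).
Qed.

Let approx := approximable P (word 0).

Let approx_sigma_algebra : sigma_algebra setT approx.
Proof. exact: (approximable_sigma_algebra P mword tword). Qed.

Let approx_sign i (B : set R) : approx [set w | B (0 <= out 0 i w)%R%:R].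
Proof.
rewrite (_ : [set w | _] =
    [set w | (fun b => `[< B (nth false b i)%:R >]) (word 0 i.+1 w)]).
  exact: (@approximable_cyl _ T R P (word 0) mword tword i.+1
    (fun b => `[< B (nth false b i)%:R >])).
by apply: eq_set => w; rewrite nth_word// asboolE.
Qed.

Let approx_event S : csig S -> approx [set w | S (tail_bits [::] w)].
Proof.
apply: (@csig_preimage _ (tail_bits [::]) approx approx_sigma_algebra).
by move=> i B _; rewrite /tail_bits /= subn0; exact: approx_sign.
Qed.

Let pr A : R := fine (P A).

(** Given the word [b], the sign sequence is [b] followed by the signs of the shifted sample point,
    which is independent of the word and has law [P]. *)
Let pr_event S n b : size b = n -> csig S ->
  pr ([set w | S (tail_bits [::] w)] `&` [set w | word 0 n w == b]) =
  (2^-1 ^+ n * pr [set w | S (tail_bits b w)])%R.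
Proof.
move=> sb cS; rewrite /pr -[X in (X * _)%R]/(fine (2^-1 ^+ n)%:E) -fineM//; last first.
  by rewrite fin_num_measure//; exact: mevent.
congr fine; rewrite -(word_shift_indep 0 sb (mevent b cS)); congr (P _).
rewrite atomE setIC; apply/seteqP; split => w /= [wb].
  by rewrite (tail_bits_word n w) wb.
by move=> Sw; rewrite (tail_bits_word n w) wb.
Qed.

Let pr_atom n b : size b = n -> pr [set w | word 0 n w == b] = (2^-1 ^+ n)%R.
Proof. by move=> sb; rewrite /pr Patom. Qed.

Let pr_le A B : measurable A -> measurable B -> A `<=` B -> (pr A <= pr B)%R.
Proof.
move=> mA mB AB; rewrite fine_le ?fin_num_measure//.
by apply: le_measure; rewrite ?inE.
Qed.

Let prU A B : measurable A -> measurable B -> A `&` B = set0 ->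
  pr (A `|` B) = (pr A + pr B)%R.
Proof.
by move=> mA mB AB; rewrite /pr measureU// fineD ?fin_num_measure.
Qed.

(** By [pr_event], the conditional probability given a word is that of the event with its first
    signs frozen, so conditions on coordinates become conditions on atoms. The hypothesis on [SC]
    expresses at once that it is increasing and that it depends on [J] only. *)
Let neg_corr_events (J : set nat) (E : set T) (SD SC : set (nat -> R)) :
  measurable E -> csig SD -> csig SC ->
  (forall n b b', size b = n -> all2 implb b b' ->
    (pr (E `&` [set w | word 0 n w == b']) <= pr (E `&` [set w | word 0 n w == b]))%R) ->
  (forall x y, (forall i, ~ J i -> x i = y i) -> SD x -> SD y) ->
  (forall x y, (forall i, J i -> x i <= y i)%R -> SC x -> SC y) ->
  (pr (E `&` [set w | SD (tail_bits [::] w)] `&` [set w | SC (tail_bits [::] w)]) <=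
   pr (E `&` [set w | SD (tail_bits [::] w)]) * pr [set w | SC (tail_bits [::] w)])%R.
Proof.
move=> mE cD cC Emono DJ CJ.
have half0 n : (0 <= 2^-1 ^+ n :> R)%R by rewrite exprn_ge0.
have tb_le b b' w i : size b = size b' -> (forall i, nth false b i ==> nth false b' i) ->
    (tail_bits b w i <= tail_bits b' w i)%R.
  move=> sb bb'; rewrite /tail_bits sb; case: ltnP => // _.
  by rewrite ler_nat; move: (bb' i); case: (nth false b i); case: (nth false b' i).
have nth_le (b b' : seq bool) : all2 implb b b' ->
    size b = size b' /\ forall i, nth false b i ==> nth false b' i.
  elim: b b' => [|x b IH] [|x' b']//=; first by split=> // i; rewrite nth_nil.
  move=> /andP[xx' /IH[-> H]].
  by split => // -[|i] //=; exact: H.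
have tb_eq b b' w i : size b = size b' -> nth false b i = nth false b' i ->
    tail_bits b w i = tail_bits b' w i.
  by move=> sb bb'; rewrite /tail_bits sb bb'.
apply: (approximable_neg_corr sword mword Patom (J := J)) => //.
- exact: approx_event.
- exact: approx_event.
- move=> n b b' sb sb' bb'; rewrite -!/(pr _) !pr_event//; congr (_ * pr _)%R.
  apply/seteqP; split => w /=; apply: DJ => i /bb' ?; apply: tb_eq => //; by rewrite sb sb'.
- move=> n b b' sb /nth_le[ss bb']; rewrite -!/(pr _) !pr_event// -?ss//.
  rewrite ler_wpM2l//; apply: pr_le; [exact: mevent|exact: mevent|].
  by move=> w /=; apply: CJ => i _; exact: tb_le.
- move=> n b b' sb sb' bb'; rewrite -!/(pr _) !pr_event//; congr (_ * pr _)%R.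
  apply/seteqP; split => w /=; apply: CJ => i /bb' ?;
    by rewrite (@tb_eq b b') ?sb ?sb'// (@tb_eq b' b) ?sb ?sb'.
Qed.

Let consR (v : R) (x : nat -> R) (i : nat) : R := if i is j.+1 then x j else v.

Let trajectory_threshold w :
  trajectory threshold w = consR (0 <= s w)%R%:R (tail_bits [::] w).
Proof.
apply/funext => -[|i]; rewrite /trajectory thresholdE//=.
by rewrite /tail_bits /= subn0.
Qed.

Let csig_cons v f u : measurable_functional f ->
  csig [set x | u <= f (consR v x)]%R.
Proof.
move=> mf; pose S := f @^-1` `[u, +oo[%classic.
have cS : csig S by apply: mf; exact: measurable_itv.
rewrite (_ : [set x | _] = consR v @^-1` S); last first.
  by apply/seteqP; split => x; rewrite /S /= in_itv/= andbT.
apply: (@csig_preimage _ (consR v) csig csig_sigma_algebra) => // -[|i] B mB /=.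
  have [hB|hB] := pselect (B v).
    rewrite (_ : [set u | _] = ~` set0); last by rewrite setC0; apply/seteqP; split.
    rewrite -setTD; case: csig_sigma_algebra => c0 cC _; exact: cC.
  rewrite (_ : [set u | _] = set0); last by apply/seteqP; split.
  by case: csig_sigma_algebra.
by apply: sub_sigma_algebra; exists i => //; exists B => //; rewrite setTI.
Qed.

(** The event [u <= f] is the disjoint union of [D0], where it holds already with [X_0 = 0], and of
    the intersection of [E] with [D1], where it needs [X_0 = 1]. Neither [D0] nor [D1] involves
    coordinate 0 or those in [J], so [neg_corr_events] applies to each piece, with [setT] and with
    [E], and the two inequalities add up. *)
Let neg_corr_sets (I J : set nat) f g u v :
  I `&` J = set0 -> ~ J 0%N -> depends_only_on I f -> depends_only_on J g ->
  measurable_functional f -> measurable_functional g ->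
  coordinatewise_nondecreasing f -> coordinatewise_nondecreasing g ->
  (pr ([set w | u <= f (trajectory threshold w)] `&`
       [set w | v <= g (trajectory threshold w)]) <=
   pr [set w | u <= f (trajectory threshold w)] *
   pr [set w | v <= g (trajectory threshold w)])%R.
Proof.
move=> IJ J0 fI gJ mf mg incf incg.
set A := [set w | u <= _]%R; set C := [set w | v <= _]%R.
pose S0 := [set x | u <= f (consR 0 x)]%R; pose S1 := [set x | u <= f (consR 1 x)]%R.
pose SC := [set x | v <= g (consR 0 x)]%R.
have cS0 : csig S0 by exact: csig_cons.
have cS1 : csig S1 by exact: csig_cons.
have cSC : csig SC by exact: csig_cons.
have cS10 : csig (S1 `\` S0).
  have -> : S1 `\` S0 = setT `\` ((setT `\` S1) `|` S0).
    rewrite !setTD setCU setCK; by [].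
  case: csig_sigma_algebra => c0 cC cU; apply: (cC _).
  rewrite -bigcup2E; apply: (cU _) => -[|[|n]] //=; exact: (cC _).
have inc01 x : (f (consR 0 x) <= f (consR 1 x))%R.
  by apply: incf => -[|i] //=.
pose E := [set w | 0 <= s w]%R.
have mE : measurable E by exact: ms_ge.
pose D0 := [set w | S0 (tail_bits [::] w)].
pose D1 := [set w | (S1 `\` S0) (tail_bits [::] w)].
have mD0 : measurable D0 by exact: mevent.
have mD1 : measurable D1 by exact: mevent.
have CE : C = [set w | SC (tail_bits [::] w)].
  apply/seteqP; split => w; rewrite /C /SC /= trajectory_threshold;
  by rewrite (gJ _ (consR 0 (tail_bits [::] w)))// => -[|i].
have mC : measurable C by rewrite CE; exact: mevent.
have AE : A = D0 `|` (E `&` D1).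
  apply/seteqP; split => w; rewrite /A /D0 /D1 /S0 /S1 /E /= trajectory_threshold.
    have [uf|uf] := pselect (u <= f (consR 0 (tail_bits [::] w)))%R; first by left.
    by case: (leP 0%R (s w)) => // _ h1; right.
  case: (leP 0%R (s w)) => _ [h0|[// _ []]] //.
  by apply: le_trans h0 _.
have disj : D0 `&` (E `&` D1) = set0.
  by rewrite -subset0 => w [h0 [_ [_]]].
have Jnot i : I i.+1 -> ~ J i.+1.
  by move=> Ii Ji; have : (I `&` J) i.+1 by []; rewrite IJ.
have f_tail c x y : (forall i, ~ J i.+1 -> x i = y i) ->
    f (consR c x) = f (consR c y).
  by move=> xy; apply: fI => -[|i] //= /Jnot; exact: xy.
have SCup x y : (forall i, J i.+1 -> x i <= y i)%R -> SC x -> SC y.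
  move=> xy; rewrite /SC /= => /le_trans; apply.
  (* The order between [x] and [y] is known on [J] only. The maximum dominates [x] everywhere and
     agrees with [y] on the coordinates that [g] sees. *)
  pose y' i := Order.max (x i) (y i).
  rewrite (gJ (consR 0 y) (consR 0 y')).
    by apply: incg => -[|i] //=; rewrite le_max lexx.
  by move=> [|i] //= /xy; rewrite /y' => /max_idPr ->.
have k0 := @neg_corr_events [set i | J i.+1] setT S0 SC measurableT cS0 cSC.
have k1 := @neg_corr_events [set i | J i.+1] E (S1 `\` S0) SC mE cS10 cSC.
rewrite AE setIUl prU; last 3 first.
- exact: measurableI.
- by apply: measurableI => //; exact: measurableI.
- by rewrite setIACA disj set0I.
rewrite prU//; last exact: measurableI.
rewrite mulrDl; apply: lerD.
- move: k0; rewrite !setTI -CE -/D0; apply.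
  + move=> n b b' sb bb'; rewrite !setTI !pr_atom//.
    by rewrite -sb; elim: b b' bb' {sb} => [|x b IH] [|x' b']//= /andP[_ /IH->].
  + by move=> x y xy; rewrite /S0 /= (f_tail _ _ _ xy).
  + exact: SCup.
- move: k1; rewrite -CE -/D1; apply.
  + move=> n b b' sb bb'; rewrite /pr fine_le ?fin_num_measure//.
    * by apply: measurableI => //; exact: mword n (pred1 b').
    * by apply: measurableI => //; exact: mword n (pred1 b).
    * by rewrite !atomE; exact: level_mono.
  + by move=> x y xy; rewrite /S0 /S1 /= !(f_tail _ _ _ xy).
  + exact: SCup.
Qed.

Lemma threshold_negatively_associated : negatively_associated threshold.
Proof.
move=> I J f g IJ fI gJ mf mg incf incg If Ig Ifg.
(* Index 0 lies in at most one of [I] and [J]; if it lies in [J], the two functions exchange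
   roles. *)
have [J0|J0] := pselect (J 0%N).
  have I0 : ~ I 0%N by move=> I0; have : (I `&` J) 0%N by []; rewrite IJ.
  rewrite muleC (_ : (fun w => _) =
    (fun w => g (trajectory threshold w) * f (trajectory threshold w))%R); last first.
    by apply/funext => w; rewrite mulrC.
  apply: expectation_neg_corr => //.
    by under eq_fun do rewrite mulrC.
  by move=> u v; apply: (@neg_corr_sets J I) => //; rewrite setIC.
apply: expectation_neg_corr => // u v.
exact: (@neg_corr_sets I J).
Qed.

Let thresholdS i w : threshold i.+1 w = (0 <= out 0 i w)%R%:R%R.
Proof. exact: thresholdE. Qed.

Lemma threshold_trivial_tail : trivial_tail threshold.
Proof.
move=> E tE.
have sub : forall (Q : set (set T)), sigma_algebra setT Q -> forall n,
    (forall i (B : set R), measurable B -> (n <= i)%N ->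
      Q [set w | B (0 <= out 0 i w)%R%:R%R]) -> Q E.
  (* Output [n] is component [n.+1] of the process, so the tail from [n.+1] on involves only outputs
     from [n] on, and never [X_0]. *)
  move=> Q sQ n gQ; apply: (@smallest_sub _ (sigma_algebra setT) _ _ sQ _ E (tE n.+1 Logic.I)).
  move=> _ [[|i] //= ni [B mB <-]]; rewrite setTI.
  rewrite (_ : _ @^-1` _ = [set w | B (0 <= out 0 i w)%R%:R%R]); first exact: gQ.
  by apply: eq_set => w; congr (B _); exact: thresholdS.
have aE : approx E.
  by apply: (sub approx approx_sigma_algebra 0%N) => i B _ _; exact: approx_sign.
apply: (@approximable_trivial _ _ _ P (word 0) sword mword Patom E aE) => n b sb.
(* For every [n] the tail event is an event of the chain shifted [n] times, hence independent of the
   first [n] signs. *)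
have [A mA EA] : preimage_set_system setT (shift 0 n) measurable E.
  apply: (sub _ (sigma_algebra_preimage setT (shift 0 n) (@sigma_algebra_measurable _ T)) n).
  move=> i B mB ni; exists [set w | B (0 <= out n (i - n) w)%R%:R%R].
    exact: (@measurable_preimageT _ _ T mR _ _ (msign_fun _ _) mB).
  rewrite setTI; apply: eq_set => w /=.
  by rewrite -{2}(subnKC ni) out_shift add0n.
rewrite -EA setTI setIC atomE word_shift_indep// shift_preserving//.
by rewrite fineM// fin_num_measure.
Qed.

Let P_threshold i : P [set w | 0 <= gproc i w]%R = 2^-1%:E.
Proof.
have mI : measurable (`[0%R, +oo[%classic : set mR) by exact: measurable_itv.
case: i => [|n] /=.
  rewrite -gauss_ge0 -(Ps mI); congr (P _).
  by apply: eq_set => w; rewrite /= in_itv/= andbT.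
pose S : set (mR * mR) := setT `*` `[0%R, +oo[%classic.
have mS : measurable S by exact: measurableX.
transitivity (P [set w | S (s w, out 0 n w)]).
  congr (P _); apply/seteqP; split => w; rewrite /S /= in_itv/= andbT//.
  by case.
apply: (etrans (law_s_out 0 n mS)).
transitivity ((gauss \x gauss) S).
  by congr ((gauss \x gauss) _); apply/seteqP; split => z; rewrite /S /=.
apply: (etrans (product_measure1E gauss gauss measurableT mI)).
rewrite -gauss_ge0 -[RHS]mul1e; congr (_ * _); exact: (probability_setT gauss).
Qed.

Let c0 : R := normal_pdf 0 1 1 * normal_pdf 0 1 2.

(** Both events have probability 1/2, so the covariance is the joint probability minus 1/4, which
    [joint_positive] makes negative enough. *)
Lemma covariance_threshold n :
  (c0 * eps 0 n)%:E <= `|covariance P (threshold 0) (threshold n.+1)|.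
Proof.
have Lind A : measurable A -> (\1_A : T -> R) \in Lfun P 1.
  move=> mA; apply/Lfun1_integrable; exact: (@integrable_indic _ T R P A mA).
have m0 := mge 0; have mn := mge n.+1.
have XY : ((\1_[set w | 0 <= gproc 0 w]%R : T -> R) * \1_[set w | 0 <= gproc n.+1 w]%R)%R =
    \1_([set w | 0 <= gproc 0 w]%R `&` [set w | 0 <= gproc n.+1 w]%R).
  by apply/funext => w; rewrite indicI.
have mI := measurableI _ _ m0 mn.
rewrite covarianceE; [|exact: Lind|exact: Lind|by rewrite XY; exact: Lind].
rewrite XY !expectation_indic// !P_threshold -(fineK (fin_num_measure P _ mI)).
rewrite -EFinM -EFinB lee_fin; have := joint_positive 0 n; rewrite -/c0 /=.
set x := fine _ => hx; rewrite ler0_norm; first by lra.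
have /andP[e0 _] := eps_itv 0 n.
have : (0 <= c0 * eps 0 n)%R by rewrite !mulr_ge0 ?normal_pdf_ge0// ltW.
lra.
Qed.

End gaussian_chain.

(** * Choice of the angles and divergence of the covariance series *)

Lemma harmonic_dominated_not_summable (R : realType) (c : R) (a : (\bar R)^nat) :
  0 < c -> (forall n, (0 <= a n)%E) -> (forall n, ((c / n.+2%:R)%:E <= a n.+1)%E) ->
  ~ (\sum_(0 <= j <oo) a j < +oo)%E.
Proof.
move=> c_gt0 a0 ca aoo; apply: (@dvg_harmonic R).
apply: nondecreasing_is_cvgn.
  apply/nondecreasing_seqP => n; rewrite !seriesEnat/= big_nat_recr//= lerDl.
  exact: harmonic_ge0.
set S := (\sum_(0 <= j <oo) a j)%E in aoo *.
have S0 : (0 <= S)%E by exact: nneseries_ge0.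
have fS : S \is a fin_num by rewrite ge0_fin_numE.
(* The 1 pays for the first harmonic term; each later term [1 / (i + 2)] is at most [a i.+1 / c]. *)
exists (1 + fine S / c) => _ [n _ <-]; rewrite seriesEnat/=.
have part N : ((\sum_(0 <= j < N) a j) <= S)%E by exact: nneseries_lim_ge.
case: n => [|n]; first by rewrite big_geq// addr_ge0// divr_ge0 ?fine_ge0// ltW.
rewrite big_nat_recl//=; apply: lerD.
  by rewrite /harmonic invr1.
rewrite ler_pdivlMr// mulr_suml -lee_fin fineK// -sumEFin.
apply: le_trans (part n.+1); rewrite big_nat_recl//.
rewrite -[leLHS]add0e; apply: leeD => //.
apply: lee_sum => i _; apply: le_trans (ca i).
by rewrite lee_fin mulrC.
Qed.

Section construction.
Context {R : realType}.
Local Notation mR := (measurableTypeR R).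

(** With this sine the squared cosine is [(m + 1) * (m + 3) / (m + 2) ^+ 2], whose products
    telescope. *)
Definition angle_sin (m : nat) : R := m.+2%:R^-1.
Definition angle_cos (m : nat) : R := Num.sqrt (1 - angle_sin m ^+ 2).

Lemma angle_sin_gt0 m : 0 < angle_sin m. Proof. by rewrite invr_gt0 ltr0n. Qed.

Lemma angle_sin_lt1 m : angle_sin m < 1.
Proof. by rewrite invf_lt1 ?ltr0n// ltr1n. Qed.

Lemma angle_cos_sqr m : angle_cos m ^+ 2 = 1 - angle_sin m ^+ 2.
Proof. by rewrite sqr_sqrtr// subr_ge0 expr_le1 ?ltW ?angle_sin_gt0 ?angle_sin_lt1. Qed.

Lemma angle_cos_gt0 m : 0 < angle_cos m.
Proof.
by rewrite sqrtr_gt0 subr_gt0 expr_lt1 ?angle_sin_lt1 ?ltW ?angle_sin_gt0 ?angle_sin_lt1.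
Qed.

Lemma angle_cos_sin m : angle_cos m ^+ 2 + angle_sin m ^+ 2 = 1.
Proof. by rewrite angle_cos_sqr subrK. Qed.

(* [angle_cos m >= angle_cos m ^+ 2] makes the product telescope. *)
Lemma eps_lower m n :
  m.+1%:R / m.+2%:R / (m + n).+2%:R <= eps angle_cos angle_sin m n.
Proof.
elim: n m => [|n IH] m /=.
  rewrite addn0 ler_piMl ?invr_ge0 ?ler0n// ler_pdivrMr ?ltr0n// mul1r ler_nat.
  exact: leqnSn.
have c2 : angle_cos m ^+ 2 <= angle_cos m.
  have c1 : angle_cos m <= 1.
    rewrite -[leRHS]sqrtr1 ler_wsqrtr// gerBl sqr_ge0//.
  by rewrite expr2 ler_piMr// ltW// angle_cos_gt0.
apply: le_trans (ler_wpM2l (ltW (angle_cos_gt0 m)) (IH m.+1)).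
rewrite addSn addnS mulrA; apply: ler_wpM2r; first by rewrite invr_ge0 ler0n.
(* With the squared cosine the inequality becomes an equality: [(m + 1) * (m + 3) / (m + 2) ^+ 2]
   times [(m + 2) / (m + 3)] is [(m + 1) / (m + 2)]. *)
apply: (@le_trans _ _ (angle_cos m ^+ 2 * (m.+2%:R / m.+3%:R))).
  have -> : m.+3%:R = m.+1%:R + 2 :> R by rewrite -natrD addn2.
  have m2 : m.+2%:R = m.+1%:R + 1 :> R by rewrite natr1.
  have m1 : 0 < m.+1%:R :> R by rewrite ltr0n.
  rewrite angle_cos_sqr /angle_sin m2 le_eqVlt; apply/orP; left; apply/eqP.
  by field; apply/andP; split; lra.
apply: ler_wpM2r => //; by rewrite divr_ge0 ?ler0n.
Qed.

End construction.

Lemma normal_pdf01_gt0 (R : realType) (x : R) : 0 < normal_pdf 0 1 x.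
Proof.
by rewrite normal_pdfE ?oner_neq0// mulr_gt0 ?expR_gt0 ?normal_peak_gt0 ?oner_neq0.
Qed.

Theorem mainTheorem7 (R : realType) :
  exists (d : measure_display) (T : measurableType d) (P : probability T R)
    (X : nat -> {RV P >-> R}),
    gaussian_threshold_process X /\
    negatively_associated X /\
    trivial_tail X /\
    ~ summable_covariances X.
Proof.
pose mR := measurableTypeR R.
pose P : probability (mR * mR)%type R := base.
pose st m := step (@angle_cos R m) (angle_sin m).
pose h m w : R := (st m w).1.
pose t m w : mR * mR := (st m w).2.
pose s (w : mR * mR) : R := w.1.
have htE m : head_tail h t m = st m.
  by apply/funext => w; rewrite /head_tail /h /t -surjective_pairing.
have mht m : measurable_fun setT (head_tail h t m) by rewrite htE; exact: measurable_step.
have Pht m (S : set (mR * (mR * mR))) : measurable S ->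
    P (head_tail h t m @^-1` S) = (@gauss R \x P)%E S.
  move=> mS; rewrite htE; apply: base_step => //; last exact: angle_cos_sin.
  by rewrite gt_eqF// angle_cos_gt0.
have ms : measurable_fun setT (s : mR * mR -> mR) by exact: measurable_fst.
have Ps (B : set mR) : measurable B -> P (s @^-1` B) = @gauss R B.
  move=> mB; have -> : s @^-1` B = B `*` setT by apply/seteqP; split => w //= [].
  apply: (etrans (product_measure1E (@gauss R) (@unif R) mB measurableT)).
  rewrite -[RHS]mule1; congr (_ * _)%E; exact: (probability_setT (@unif R)).
have sE m (w : mR * mR) : s w = angle_cos m * s (t m w) - angle_sin m * h m w.
  rewrite /s /t /h /st /step /=.
  transitivity ((angle_cos m ^+ 2 + angle_sin m ^+ 2) * w.1).
    by rewrite angle_cos_sin mul1r.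
  by ring.
exists _, _, P, (threshold P mht ms); split; first exact: threshold_process Pht ms Ps sE.
split.
  exact: (threshold_negatively_associated Pht sE (@angle_cos_gt0 R) (@angle_sin_gt0 R)).
split; first exact: threshold_trivial_tail.
(* The two densities come from [joint_positive]; the 1/2 is the factor [m.+1%:R / m.+2%:R] of
   [eps_lower] at [m = 0]. *)
pose c : R := normal_pdf 0 1 1 * normal_pdf 0 1 2 / 2.
have c_gt0 : 0 < c by rewrite divr_gt0// mulr_gt0// normal_pdf01_gt0.
move=> /(_ 0%N); apply: (harmonic_dominated_not_summable c_gt0) => [n|n].
  exact: abse_ge0.
apply: le_trans (covariance_threshold mht Pht ms Ps sE (@angle_cos_gt0 R)
  (@angle_sin_gt0 R) (@angle_cos_sin R) n).
rewrite lee_fin /c -!mulrA; apply: ler_wpM2l; first exact: normal_pdf_ge0.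
apply: ler_wpM2l; first exact: normal_pdf_ge0.
by apply: le_trans (eps_lower 0 n); rewrite div1r add0n.
Qed.
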